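(* Let $f_1,\dots,f_n:\mathbb{R}^d\to\mathbb{R}$ be differentiable and let $f=\frac1n\sum_{i=1}^nf_i$. Suppose that $f$ and $f_1,\dots,f_n$ are all $L$-smooth, that $f$ is bounded from below by $f_\ast\in\mathbb{R}$, and that, if $f$ is convex, it has a minimizer $x_\ast\in\mathbb{R}^d$; in that case let $\sigma_\ast^2=\frac1n\sum_{i=1}^n\|\nabla f_i(x_\ast)\|^2$. Consider the Incremental Gradient method run for $T\ge1$ epochs from $x_0\in\mathbb{R}^d$ with stepsize $\gamma>0$, and let $\varepsilon>0$. Then the following hold. (1) If each $f_i$ is $\mu$-strongly convex with $\mu>0$ and $\gamma\le\frac1L$, then $$\|x_T-x_\ast\|^2\le(1-\gamma\mu)^{nT}\|x_0-x_\ast\|^2+\frac{\gamma^2Ln^2\sigma_\ast^2}{\mu}.$$ Consequently, for a suitable choice of the stepsize, the method reaches a point $\tilde x$ with $\|\tilde x-x_\ast\|^2\le\varepsilon$ after a total number $nT=\tilde{\mathcal O}\left(\kappa+\frac{\sqrt\kappa\,n\sigma_\ast}{\mu\sqrt\varepsilon}\right)$ of individual gradient evaluations, where $\kappa=L/\mu$. (2) If $f$ is $\mu$-strongly convex with $\mu>0$, each $f_i$ is convex and $\gamma\le\frac{1}{\sqrt2\,nL}$, then, with $\kappa=L/\mu$, $$\|x_T-x_\ast\|^2\le\left(1-\frac{\gamma\mu n}{2}\right)^T\|x_0-x_\ast\|^2+2\gamma^2\kappa n^2\sigma_\ast^2.$$ Consequently, for a suitable choice of the stepsize, the method reaches a point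 $\tilde x$ with $\|\tilde x-x_\ast\|^2\le\varepsilon$ after $\tilde{\mathcal O}\left(n\kappa+\frac{\sqrt\kappa\,n\sigma_\ast}{\mu\sqrt\varepsilon}\right)$ individual gradient evaluations. (3) If each $f_i$ is convex and $\gamma\le\frac{1}{\sqrt2\,nL}$, then $$f(\hat x_T)-f(x_\ast)\le\frac{\|x_0-x_\ast\|^2}{2\gamma nT}+\frac{\gamma^2Ln^2\sigma_\ast^2}{2},\qquad \hat x_T=\frac1T\sum_{t=1}^Tx_t.$$ With the stepsize $\gamma=\min\left\{\frac{1}{\sqrt2\,nL},\frac{\sqrt\varepsilon}{\sqrt L\,n\sigma_\ast}\right\}$ one has $f(\hat x_T)-f(x_\ast)\le\varepsilon$ provided that $$nT\ge\frac{\|x_0-x_\ast\|^2}{\varepsilon}\max\left\{\sqrt8\,nL,\frac{\sqrt L\,\sigma_\ast n}{\sqrt\varepsilon}\right\}.$$ (4) (Each $f_i$ possibly non-convex.) If there are constants $A,B\ge0$ such that $\frac1n\sum_{i=1}^n\|\nabla f_i(x)-\nabla f(x)\|^2\le2A(f(x)-f_\ast)+B^2$ for all $x\in\mathbb{R}^d$, and $\gamma\le\min\left\{\frac{1}{\sqrt8\,nL},\frac{1}{(4L^2n^3AT)^{1/3}}\right\}$, then $$\min_{t=0,\dots,T-1}\|\nabla f(x_t)\|^2\le\frac{12\,(f(x_0)-f_\ast)}{\gamma nT}+8\gamma^2L^2n^2B^2.$$ Moreover, for a suitable choice of the stepsize, the method reaches a point with gradient norm less than $\varepsilon$ provided that the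 total number of iterations $nT$ exceeds $$\frac{48\,(f(x_0)-f_\ast)Ln}{\varepsilon^2}\max\left\{\sqrt2,\frac{\sqrt{24\,(f(x_0)-f_\ast)A}}{\varepsilon},\frac{2B}{\varepsilon}\right\}.$$
   Context: $L$-smooth means that the gradient is $L$-Lipschitz. Incremental Gradient (IG) method: given a stepsize $\gamma>0$, a starting point $x_0\in\mathbb{R}^d$ and a number of epochs $T$, in each epoch $t=0,1,\dots,T-1$ set $x_t^0=x_t$, perform $x_t^{i+1}=x_t^i-\gamma\nabla f_{i+1}(x_t^i)$ for $i=0,1,\dots,n-1$ (deterministic cyclic order), and set $x_{t+1}=x_t^n$. $\tilde{\mathcal O}(\cdot)$ ignores absolute constants and factors polylogarithmic in the problem parameters ($L$, $\mu$, $n$, $\|x_0-x_\ast\|$, $\sigma_\ast$, $1/\varepsilon$). A term with zero denominator inside a minimum of stepsizes is read as $+\infty$. The suitable stepsize may depend on the problem parameters and on $n$, $T$, $\varepsilon$. *)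

(* Defs.v *)
From mathcomp Require Import all_boot all_order all_algebra.
From mathcomp Require Import all_classical all_reals all_analysis.

Set Implicit Arguments.
Unset Strict Implicit.
Unset Printing Implicit Defensive.

Import Order.TTheory GRing.Theory Num.Theory.
Import numFieldNormedType.Exports.

Local Open Scope ring_scope.

Section Defs.
Context {R : realType} {d : nat}.
Implicit Types (phi : 'rV[R]_d -> R) (v x y : 'rV[R]_d).

(* The canonical norm `|v| on row vectors is the sup norm, hence a separate
   Euclidean norm. *)
Definition enorm v : R := Num.sqrt (\sum_(j < d) v ord0 j ^+ 2).

Definition grad phi x : 'rV[R]_d := \row_(j < d) 'D_(delta_mx ord0 j) phi x.

Definition smooth (L : R) phi : Prop :=
  forall x y, enorm (grad phi x - grad phi y) <= L * enorm (x - y).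

Definition convex phi : Prop := convex_function (@setT 'rV[R]_d) phi.

Definition strongly_convex (mu : R) phi : Prop :=
  convex (fun x => phi x - mu / 2 * enorm x ^+ 2).

Definition minimizer phi x : Prop := forall y, phi x <= phi y.

Context {n : nat}.
Implicit Type f : 'I_n -> 'rV[R]_d -> R.

Definition favg f x : R := n%:R^-1 * \sum_(i < n) f i x.

Definition sigma_star f x : R :=
  Num.sqrt (n%:R^-1 * \sum_(i < n) enorm (grad (f i) x) ^+ 2).

(* enum 'I_n lists the indices in increasing order, so the components are
   visited cyclically; component i here is f_{i+1} in 1-based numbering. *)
Definition IG_epoch f (gamma : R) x : 'rV[R]_d :=
  foldl (fun y i => y - gamma *: grad (f i) y) x (enum 'I_n).

Definition IG f (gamma : R) (x0 : 'rV[R]_d) (t : nat) : 'rV[R]_d :=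
  iter t (IG_epoch f gamma) x0.

Definition IG_avg f (gamma : R) (x0 : 'rV[R]_d) (T : nat) : 'rV[R]_d :=
  T%:R^-1 *: \sum_(1 <= t < T.+1) IG f gamma x0 t.

End Defs.

(* Every polylogarithmic function of the nonnegative quantities qs is at most a
   constant multiple of such a factor; \tilde O(X) is C * polylog p qs * X with
   C and p independent of the problem. *)
Definition polylog {R : realType} (p : nat) (qs : seq R) : R :=
  (1 + \sum_(q <- qs) ln (1 + q)) ^+ p.

(* The inverse in \bar R satisfies 0^-1 = +oo. *)
Definition nonconvex_step_max {R : realType} (L A : R) (n T : nat) : \bar R :=
  Order.min ((Num.sqrt 8 * n%:R * L)%:E^-1)%E
            (((4 * L ^+ 2 * n%:R ^+ 3 * A * T%:R) `^ 3^-1)%:E^-1)%E.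

(* Main.v *)
Require Import Defs.
From mathcomp Require Import all_boot all_order all_algebra.
From mathcomp Require Import all_classical all_reals all_analysis.
From mathcomp Require Import ring lra.

Set Implicit Arguments.
Unset Strict Implicit.
Unset Printing Implicit Defensive.

Import Order.TTheory GRing.Theory Num.Theory.
Import numFieldNormedType.Exports.
Local Open Scope ring_scope.

(* (1): the inner iterates are compared not with the minimizer xs but with
   xs - gamma * sum_(j < k) grad f_j(xs), the trajectory that IG would follow if
   all gradients were frozen at xs.  The three-point identity for Bregman
   divergences makes each inner step a (1 - gamma mu)-contraction of the squared
   distance to that trajectory, up to the divergence between it and xs; since
   the gradients at xs sum to zero, the trajectory is back at xs after one epoch.
   (2), (3): an epoch is an implicit gradient step, x' = x - gamma sum_j G_j with
   G_j the gradient at the j-th inner iterate y_j.  Cocoercivity and the descent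
   lemma give <G_j, x' - xs> >= f_j(x') - f_j(xs) + |G_j - g_j|^2 / (2 L)
   - (L / 2) |x' - y_j|^2 with g_j = grad f_j(xs), and the backward distances
   |x' - y_j|^2 are absorbed by the |G_j - g_j|^2 up to gamma^2 n^3 sigma^2 / 2.
   (4): the descent lemma with the forward distances |y_j - x|^2 gives
   delta' <= (1 + a) delta - b |grad f(x)|^2 + c for delta = f(x) - f_*, where the
   stepsize restriction forces T a <= 4 / 7. *)

(** * Euclidean geometry, smoothness and convexity *)

Section EuclideanGeometry.
Context {R : realType} {d : nat}.
Implicit Types (u v w x y : 'rV[R]_d) (a b : R).

Definition dot u v : R := \sum_(j < d) u ord0 j * v ord0 j.

Lemma dotC u v : dot u v = dot v u.
Proof. by apply: eq_bigr => j _; rewrite mulrC. Qed.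

Lemma dotDl u v w : dot (u + v) w = dot u w + dot v w.
Proof. by rewrite -big_split; apply: eq_bigr => j _; rewrite mxE mulrDl. Qed.

Lemma dotDr u v w : dot w (u + v) = dot w u + dot w v.
Proof. by rewrite dotC dotDl !(dotC w). Qed.

Lemma dotZl a u v : dot (a *: u) v = a * dot u v.
Proof. by rewrite mulr_sumr; apply: eq_bigr => j _; rewrite mxE mulrA. Qed.

Lemma dotZr a u v : dot u (a *: v) = a * dot u v.
Proof. by rewrite dotC dotZl dotC. Qed.

Lemma dotNl u v : dot (- u) v = - dot u v.
Proof. by rewrite -scaleN1r dotZl mulN1r. Qed.

Lemma dotNr u v : dot u (- v) = - dot u v.
Proof. by rewrite dotC dotNl dotC. Qed.

Lemma dot0l v : dot 0 v = 0.
Proof. by rewrite -(scale0r 0) dotZl mul0r. Qed.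

Definition dotE := (dotDl, dotDr, dotNl, dotNr, dotZl, dotZr).

Lemma dot_suml (I : finType) (P : pred I) (F : I -> 'rV[R]_d) v :
  dot (\sum_(i | P i) F i) v = \sum_(i | P i) dot (F i) v.
Proof.
by elim/big_rec2: _ => [|i y1 y2 _ <-]; rewrite ?dot0l ?dotDl.
Qed.

Lemma dot_sumr (I : finType) (P : pred I) (F : I -> 'rV[R]_d) v :
  dot v (\sum_(i | P i) F i) = \sum_(i | P i) dot v (F i).
Proof. by rewrite dotC dot_suml; apply: eq_bigr => i _; rewrite dotC. Qed.

Lemma dot_ge0 v : 0 <= dot v v.
Proof. by apply: sumr_ge0 => j _; rewrite -expr2 sqr_ge0. Qed.

Lemma dot_eq0 v : dot v v = 0 -> v = 0.
Proof.
move=> v0; apply/rowP => j; rewrite mxE; apply/eqP; rewrite -sqrf_eq0 expr2.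
apply/eqP; apply: (@psumr_eq0P _ _ xpredT (fun j => v ord0 j * v ord0 j)) => //.
by move=> i _; rewrite -expr2 sqr_ge0.
Qed.

Lemma enorm_sqr v : enorm v ^+ 2 = dot v v.
Proof.
rewrite /enorm sqr_sqrtr; last by apply: sumr_ge0 => j _; rewrite sqr_ge0.
by apply: eq_bigr => j _; rewrite expr2.
Qed.

Lemma enorm_ge0 v : 0 <= enorm v.
Proof. exact: sqrtr_ge0. Qed.

(** Cauchy-Schwarz: expand 0 <= | |v| u - |u| v |^2 and divide by |u| |v|; a zero norm forces a zero
    vector. *)
Lemma dot_le_enorm u v : dot u v <= enorm u * enorm v.
Proof.
have [u0|u0] := eqVneq (enorm u) 0.
  have -> : u = 0 by apply: dot_eq0; rewrite -enorm_sqr u0 expr0n.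
  by rewrite dot0l mulr_ge0 ?enorm_ge0.
have [v0|v0] := eqVneq (enorm v) 0.
  have -> : v = 0 by apply: dot_eq0; rewrite -enorm_sqr v0 expr0n.
  by rewrite dotC dot0l mulr_ge0 ?enorm_ge0.
have uv0 : 0 < enorm u * enorm v.
  by rewrite mulr_gt0// lt_neqAle eq_sym ?u0 ?v0 enorm_ge0.
have := dot_ge0 (enorm v *: u - enorm u *: v).
rewrite !dotE [dot v u]dotC -!enorm_sqr => H.
rewrite -(ler_pM2l uv0); lra.
Qed.

End EuclideanGeometry.

Lemma enorm_dim0 {R : realType} (v : 'rV[R]_0) : enorm v = 0.
Proof. by rewrite /enorm big_ord0 sqrtr0. Qed.

(** * Descent lemma, strong convexity and cocoercivity *)

Section Calculus.
Context {R : realType} {d : nat}.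
Implicit Types (phi : 'rV[R]_d -> R) (v x y : 'rV[R]_d).

Lemma derive_grad phi x v : differentiable phi x -> 'D_v phi x = dot (grad phi x) v.
Proof.
move=> dphi; rewrite deriveE// {1}[v]row_sum_delta linear_sum /dot.
by apply: eq_bigr => j _; rewrite linearZ /= mxE deriveE// mulrC.
Qed.

Lemma is_derive_line phi x v (t : R) : differentiable phi (x + t *: v) ->
  is_derive t 1 (fun s : R => phi (x + s *: v)) (dot (grad phi (x + t *: v)) v).
Proof.
move=> dphi.
have E : (fun h : R => h^-1 *: (phi (h *: v + (x + t *: v)) - phi (x + t *: v)))
  = (fun h : R => h^-1 *: (phi (x + (h *: (1 : R) + t) *: v) - phi (x + t *: v))).
  apply/funext => h; congr (_ *: (phi _ - _)).
  by rewrite [h *: 1]mulr1 scalerDl addrCA.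
apply: DeriveDef.
  have : derivable phi (x + t *: v) v by exact: diff_derivable.
  by rewrite /derivable E.
by rewrite -derive_grad// /derive E.
Qed.

(** Descent lemma without integrals. [h] is [phi] along the segment minus its quadratic upper model;
    the mean value theorem gives [h 1 - h 0 = dh c], and Cauchy-Schwarz with the Lipschitz gradient
    makes [dh c] nonpositive. *)
Lemma smooth_upper (L : R) phi x y : (forall z, differentiable phi z) ->
  smooth L phi ->
  phi y <= phi x + dot (grad phi x) (y - x) + L / 2 * dot (y - x) (y - x).
Proof.
move=> dphi Lphi; set v := y - x; set G := dot (grad phi x) v.
pose h (t : R) := phi (x + t *: v) - (t * G + t ^+ 2 * (L / 2 * dot v v)).
pose dh (t : R) := dot (grad phi (x + t *: v)) v - (G + t * (L * dot v v)).
have hd (t : R) : is_derive t 1 h (dh t).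
  apply: is_deriveB.
    exact: is_derive_line.
  apply: is_derive_eq.
  by rewrite /GRing.scale/=; field.
have [c c01 hc] : exists2 c, c \in `]0, 1[%R & h 1 - h 0 = dh c * (1 - 0).
  apply: MVT => //; apply: derivable_within_continuous => t _.
  exact: ex_derive.
suff : h 1 <= h 0.
  by rewrite /h scale1r scale0r addr0 subrKC; lra.
rewrite -subr_le0 hc subr0 mulr1 /dh; move: c01; rewrite in_itv/= => /andP[c0 _].
have -> : dot (grad phi (x + c *: v)) v
    = dot (grad phi (x + c *: v) - grad phi x) v + G.
  by rewrite /G !dotE; ring.
have := dot_le_enorm (grad phi (x + c *: v) - grad phi x) v.
have := ler_wpM2r (enorm_ge0 v) (Lphi (x + c *: v) x).
rewrite [x + _]addrC addrK.
have -> : enorm (c *: v) = c * enorm v.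
  apply/eqP; rewrite -(eqrXn2 (n:=2)) ?enorm_ge0 ?mulr_ge0 ?enorm_ge0 ?ltW//.
  by rewrite exprMn !enorm_sqr !dotE; apply/eqP; ring.
have -> : L * (c * enorm v) * enorm v = c * (L * enorm v ^+ 2) by ring.
by rewrite enorm_sqr; lra.
Qed.

Lemma gradN phi x : (forall z, differentiable phi z) ->
  grad (fun z => - phi z) x = - grad phi x.
Proof.
move=> dphi; apply/rowP => j; rewrite !mxE deriveN//.
exact: diff_derivable.
Qed.

Lemma smooth_lower (L : R) phi x y : (forall z, differentiable phi z) ->
  smooth L phi ->
  phi x + dot (grad phi x) (y - x) - L / 2 * dot (y - x) (y - x) <= phi y.
Proof.
move=> dphi Lphi.
have := @smooth_upper L (fun z => - phi z) x y.
rewrite gradN// !dotNl.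
suff dN : forall z, differentiable (fun z => - phi z) z.
  suff LN : smooth L (fun z => - phi z) by move=> /(_ dN LN); lra.
  move=> z1 z2; rewrite !gradN// -opprD.
  have -> w : enorm (- w) = enorm w :> R.
    by rewrite /enorm; congr Num.sqrt; apply: eq_bigr => j _; rewrite mxE sqrrN.
  exact: Lphi.
move=> z; exact: differentiableN.
Qed.

(** The squared norm lies below its chord by exactly t (1 - t) |y - x|^2, which converts convexity
    of [phi] minus a quadratic into this form. *)
Lemma strongly_convexP (mu : R) phi : strongly_convex mu phi <->
  forall x y (t : R), 0 <= t <= 1 ->
    phi (x + t *: (y - x)) <= (1 - t) * phi x + t * phi y
      - mu / 2 * (t * (1 - t)) * dot (y - x) (y - x).
Proof.
have conv_line x y (t : R) : t *: y + (1 - t) *: x = x + t *: (y - x).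
  by rewrite scalerBl scale1r scalerBr addrCA addrA.
split=> [cphi x y t /andP[t0 t1]|cphi t y x _ _].
  have : phi (t *: y + (1 - t) *: x)
      - mu / 2 * enorm (t *: y + (1 - t) *: x) ^+ 2
    <= t * (phi y - mu / 2 * enorm y ^+ 2)
      + (1 - t) * (phi x - mu / 2 * enorm x ^+ 2).
    by apply: (cphi (Itv01 t0 t1)); rewrite inE.
  by rewrite !enorm_sqr conv_line !dotE [dot y x]dotC; lra.
have {}cphi := cphi x y t%:num; rewrite ge0 le1 in cphi.
suff : phi (t%:num *: y + (1 - t%:num) *: x)
      - mu / 2 * enorm (t%:num *: y + (1 - t%:num) *: x) ^+ 2
    <= t%:num * (phi y - mu / 2 * enorm y ^+ 2)
      + (1 - t%:num) * (phi x - mu / 2 * enorm x ^+ 2) by [].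
by move: (cphi isT); rewrite !enorm_sqr conv_line !dotE [dot y x]dotC; lra.
Qed.

(** Lets the convex case reuse the strongly convex lemmas at modulus 0. *)
Lemma strongly_convex0 phi : convex phi <-> strongly_convex 0 phi.
Proof.
rewrite /strongly_convex.
suff -> : (fun x => phi x - 0 / 2 * enorm x ^+ 2) = phi by [].
by apply/funext => x; rewrite !mul0r subr0.
Qed.

Lemma strongly_convexW (mu : R) phi : 0 <= mu -> strongly_convex mu phi ->
  convex phi.
Proof.
move=> mu0 /strongly_convexP cphi; apply/strongly_convex0/strongly_convexP.
move=> x y t /[dup] /(cphi x y) {}cphi /andP[t0 t1]; apply: le_trans cphi _.
rewrite !mul0r subr0 gerBl !mulr_ge0 ?dot_ge0 ?subr_ge0//.
Qed.

(** By contradiction, with smoothness in place of a limit: if the inequality fails by [e > 0], the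
    chord bound and [smooth_lower] at x + t (y - x) give e <= t K for every t in (0, 1). *)
Lemma strongly_convex_ge (L mu : R) phi x y : 0 <= L ->
  (forall z, differentiable phi z) -> smooth L phi -> strongly_convex mu phi ->
  phi x + dot (grad phi x) (y - x) + mu / 2 * dot (y - x) (y - x) <= phi y.
Proof.
move=> L0 dphi Lphi cphi; have /strongly_convexP cvx := cphi.
rewrite -subr_le0; set e := (X in X <= 0).
have [//|e0] := leP e 0.
pose K := (L + mu) / 2 * dot (y - x) (y - x).
have K0 := normr_ge0 K.
(* Small enough that t |K| < e, with the summand 1 keeping t < 1. *)
pose t := e / (e + `|K| + 1).
have t0 : 0 < t by rewrite divr_gt0//; lra.
have t1 : t < 1 by rewrite ltr_pdivrMr; lra.
have := cvx x y t; rewrite (ltW t0) (ltW t1) => /(_ isT).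
have := smooth_lower x (x + t *: (y - x)) dphi Lphi.
rewrite [x + t *: _]addrC addrK !dotZl !dotZr => H1 H2.
have H : t * e <= t * (t * K) by rewrite /e /K; lra.
rewrite ler_pM2l// in H.
have : t * `|K| < e.
  by rewrite /t mulrAC ltr_pdivrMr; [rewrite ltr_pM2l|]; lra.
have := ler_norm (t * K); rewrite normrM (gtr0_norm t0); lra.
Qed.

(** Evaluate [phi] at x - w / L: the tangent plane at y bounds it from below, the descent lemma at x
    from above. *)
Lemma cocoercive (L : R) phi x y : 0 < L ->
  (forall z, differentiable phi z) -> smooth L phi -> convex phi ->
  dot (grad phi x - grad phi y) (grad phi x - grad phi y)
  <= 2 * L * (phi x - phi y - dot (grad phi y) (x - y)).
Proof.
move=> L0 dphi Lphi /strongly_convex0 cphi; set w := _ - grad phi y.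
have := smooth_upper x (x - L^-1 *: w) dphi Lphi.
have := strongly_convex_ge y (x - L^-1 *: w) (ltW L0) dphi Lphi cphi.
rewrite !mul0r addr0 [x - L^-1 *: w - x]addrAC subrr sub0r.
rewrite [x - L^-1 *: w - y]addrAC ![dot _ (_ - L^-1 *: w)]dotDr.
move: (phi (x - L^-1 *: w)) => p.
have Ew : dot w w = dot (grad phi x) w - dot (grad phi y) w by rewrite dotDl dotNl.
rewrite !dotNr !dotNl !dotZl !dotZr !opprK => H1 H2.
have {}H2 := le_trans H1 H2.
rewrite -ler_pdivrMl ?mulr_gt0//.
have -> : (2 * L)^-1 * dot w w = L^-1 * dot w w - L / 2 * (L^-1 * (L^-1 * dot w w)).
  by field; rewrite gt_eqF.
rewrite {1}Ew; lra.
Qed.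

(** A gradient step of size 1 / L lowers [phi] by at least |grad|^2 / (2 L), which minimality
    forbids unless the gradient vanishes. *)
Lemma minimizer_grad0 (L : R) phi x : 0 < L ->
  (forall z, differentiable phi z) -> smooth L phi -> minimizer phi x ->
  grad phi x = 0.
Proof.
move=> L0 dphi Lphi mx; apply: dot_eq0.
have := smooth_upper x (x - L^-1 *: grad phi x) dphi Lphi.
have := mx (x - L^-1 *: grad phi x).
rewrite [x - _ - x]addrAC subrr sub0r !dotE.
have Li : 0 < L^-1 by rewrite invr_gt0.
have := dot_ge0 (grad phi x); set q := dot _ _ => q0 H1 H2.
have : phi x <= phi x - L^-1 * q / 2.
  apply: le_trans H1 (le_trans H2 _); rewrite le_eqVlt; apply/orP; left; apply/eqP.
  by field; rewrite gt_eqF.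
have := mulr_ge0 (ltW Li) q0 => H3 H4.
have : L^-1 * q = 0 by lra.
by move=> /eqP; rewrite mulf_eq0 gt_eqF//= => /eqP.
Qed.

End Calculus.

(** * Sums of vectors and inner iterates *)

Section SumsOfVectors.
Context {R : realType} {d : nat}.
Implicit Types u v : 'rV[R]_d.

Lemma dotDD_le u v : dot (u + v) (u + v) <= 2 * dot u u + 2 * dot v v.
Proof. by have := dot_ge0 (u - v); rewrite !dotE [dot v u]dotC; lra. Qed.

(** Nonnegativity of the variance, in the form that the sum of |m F_i - S|^2 is nonnegative, where m
    counts the terms. *)
Lemma dot_sum_le (I : finType) (P : pred I) (F : I -> 'rV[R]_d) :
  dot (\sum_(i | P i) F i) (\sum_(i | P i) F i)
  <= #|P|%:R * \sum_(i | P i) dot (F i) (F i).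
Proof.
set S := \sum_(i | P i) F i; set m := #|P|%:R : R.
have [m0|m0] := eqVneq #|P| 0%N.
  have P0 : P =1 pred0 by move=> i; have := card0_eq m0 i.
  by rewrite /S !big_pred0// dot0l mulr0.
have m_gt0 : 0 < m by rewrite ltr0n lt0n.
have : 0 <= \sum_(i | P i) dot (m *: F i - S) (m *: F i - S).
  by apply: sumr_ge0 => i _; apply: dot_ge0.
have -> : \sum_(i | P i) dot (m *: F i - S) (m *: F i - S)
    = m * (m * (\sum_(i | P i) dot (F i) (F i)) - dot S S).
  rewrite (eq_bigr (fun i => m ^+ 2 * dot (F i) (F i) - 2 * m * dot (F i) S
      + dot S S)); last by move=> i _; rewrite !dotE [dot S (F i)]dotC; ring.
  rewrite !big_split/= sumrN -!mulr_sumr -dot_suml -/S sumr_const.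
  by rewrite -mulr_natl -/m; ring.
by rewrite pmulr_rge0// subr_ge0.
Qed.

Lemma card_ord_lt (n k : nat) : (#|[pred j : 'I_n | (j < k)%N]| <= k)%N.
Proof.
have [kn|nk] := leqP k n; last by rewrite (leq_trans (max_card _))// card_ord ltnW.
by rewrite -sum1_card -(big_ord_widen n (fun=> 1%N) kn) sum_nat_const card_ord muln1.
Qed.

Lemma sum_ord_le (n : nat) : \sum_(i < n) (i%:R : R) <= n%:R ^+ 2 / 2.
Proof.
elim: n => [|n IH]; first by rewrite big_ord0 expr0n/= mul0r.
rewrite big_ord_recr/= -natr1; lra.
Qed.

Lemma dot_sum_head_le (n k : nat) (F : 'I_n -> 'rV[R]_d) :
  dot (\sum_(j < n | (j < k)%N) F j) (\sum_(j < n | (j < k)%N) F j)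
  <= k%:R * \sum_(j < n) dot (F j) (F j).
Proof.
apply: le_trans (dot_sum_le _ _) _.
apply: ler_pM => //; first by apply: sumr_ge0 => *; exact: dot_ge0.
  by rewrite ler_nat card_ord_lt.
rewrite [leRHS](bigID (fun j : 'I_n => (j < k)%N))/= lerDl.
by apply: sumr_ge0 => *; exact: dot_ge0.
Qed.

(** The i-th prefix has i terms, and these lengths sum to at most n^2 / 2. *)
Lemma sum_dot_sum_head_le (n : nat) (F : 'I_n -> 'rV[R]_d) :
  \sum_(i < n) dot (\sum_(j < n | (j < i)%N) F j) (\sum_(j < n | (j < i)%N) F j)
  <= n%:R ^+ 2 / 2 * \sum_(j < n) dot (F j) (F j).
Proof.
apply: (@le_trans _ _ (\sum_(i < n) (i%:R * \sum_(j < n) dot (F j) (F j)))).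
  by apply: ler_sum => i _; apply: dot_sum_head_le.
rewrite -mulr_suml ler_wpM2r ?sum_ord_le//.
by apply: sumr_ge0 => *; exact: dot_ge0.
Qed.

(** Each tail is bounded crudely by n terms; the constant n^2 is what the stepsize restriction of
    [convex_epoch] can absorb. *)
Lemma sum_dot_sum_tail_le (n : nat) (F : 'I_n -> 'rV[R]_d) :
  \sum_(i < n) dot (\sum_(j < n | ~~ (j < i)%N) F j) (\sum_(j < n | ~~ (j < i)%N) F j)
  <= n%:R ^+ 2 * \sum_(j < n) dot (F j) (F j).
Proof.
have F0 : 0 <= \sum_(j < n) dot (F j) (F j) by apply: sumr_ge0 => *; exact: dot_ge0.
apply: (@le_trans _ _ (\sum_(i < n) (n%:R * \sum_(j < n) dot (F j) (F j)))); last first.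
  by rewrite sumr_const card_ord -[leLHS]mulr_natl mulrA expr2.
apply: ler_sum => i _; apply: le_trans (dot_sum_le _ _) _.
apply: ler_pM => //; first by apply: sumr_ge0 => *; exact: dot_ge0.
  by rewrite ler_nat (leq_trans (max_card _)) ?card_ord.
rewrite [leRHS](bigID (fun j : 'I_n => (j < i)%N))/= lerDr.
by apply: sumr_ge0 => *; exact: dot_ge0.
Qed.

End SumsOfVectors.

(** * The averaged objective, its gradient and the noise at the optimum *)

Section Average.
Context {R : realType} {d n : nat}.
Variable f : 'I_n -> 'rV[R]_d -> R.

Lemma favgE : favg f = n%:R^-1 \*: (\sum_(i < n) f i).
Proof. by apply/funext => x; rewrite /favg /= fct_sumE. Qed.

Lemma differentiable_favg x :
  (forall i, differentiable (f i) x) -> differentiable (favg f) x.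
Proof.
move=> df; rewrite favgE; apply: differentiableZ; exact: differentiable_sum.
Qed.

Lemma grad_favg x : (forall i, differentiable (f i) x) ->
  grad (favg f) x = n%:R^-1 *: \sum_(i < n) grad (f i) x.
Proof.
move=> df; apply/rowP => j; rewrite !mxE summxE favgE.
have der i : derivable (f i) x (delta_mx 0 j) by exact: diff_derivable.
rewrite deriveZ ?derive_sum//; last by apply: derivable_sum.
by congr (_ * _); apply: eq_bigr => i _; rewrite mxE.
Qed.

Lemma sum_grad x : (0 < n)%N -> (forall i, differentiable (f i) x) ->
  \sum_(i < n) grad (f i) x = n%:R *: grad (favg f) x.
Proof.
by move=> n0 df; rewrite grad_favg// scalerA divff ?scale1r// pnatr_eq0 -lt0n.
Qed.

Lemma sum_favg x : (0 < n)%N -> \sum_(i < n) f i x = n%:R * favg f x.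
Proof. by move=> n0; rewrite /favg mulVKf// pnatr_eq0 -lt0n. Qed.

Lemma convex_favg : (forall i, convex (f i)) -> convex (favg f).
Proof.
move=> cf; apply/strongly_convex0/strongly_convexP => x y t t01.
rewrite !mul0r subr0 /favg mulrCA [t * _]mulrCA -mulrDr ler_wpM2l ?invr_ge0//.
rewrite !mulr_sumr -big_split/=; apply: ler_sum => i _.
have /strongly_convex0/strongly_convexP/(_ x y t t01) := cf i.
by rewrite !mul0r subr0.
Qed.

Lemma sigma_star_sqr x : (0 < n)%N ->
  n%:R * sigma_star f x ^+ 2 = \sum_(i < n) dot (grad (f i) x) (grad (f i) x).
Proof.
move=> n0; rewrite /sigma_star sqr_sqrtr; last first.
  by rewrite mulr_ge0 ?invr_ge0// sumr_ge0// => *; rewrite sqr_ge0.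
rewrite mulVKf ?pnatr_eq0 -?lt0n//; apply: eq_bigr => i _; exact: enorm_sqr.
Qed.

End Average.

(** * Iterates inside one epoch *)

Section InnerIterates.
Context {R : realType} {d n : nat}.
Variables (f : 'I_n -> 'rV[R]_d -> R) (gamma : R).

(** The fold of [IG_epoch] cut after k components, so that k = n gives the full epoch. *)
Definition inner x (k : nat) : 'rV[R]_d :=
  foldl (fun y i => y - gamma *: grad (f i) y) x (take k (enum 'I_n)).

Lemma inner0 x : inner x 0 = x. Proof. by rewrite /inner take0. Qed.

Lemma innerS x (i : 'I_n) :
  inner x i.+1 = inner x i - gamma *: grad (f i) (inner x i).
Proof.
rewrite /inner (take_nth i) ?size_enum_ord// nth_ord_enum.
by rewrite -cats1 foldl_cat.
Qed.

Lemma inner_epoch x : inner x n = IG_epoch f gamma x.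
Proof. by rewrite /inner take_oversize// size_enum_ord. Qed.

Lemma sum_ord_ltS (F : 'I_n -> 'rV[R]_d) (i : 'I_n) :
  \sum_(j < n | (j < i.+1)%N) F j = \sum_(j < n | (j < i)%N) F j + F i.
Proof.
rewrite (bigD1 i)//= addrC; congr (_ + _); apply: eq_bigl => j.
by rewrite ltnS [RHS]ltn_neqAle andbC.
Qed.

Lemma inner_sum x (k : nat) : (k <= n)%N ->
  inner x k = x - gamma *: \sum_(j < n | (j < k)%N) grad (f j) (inner x j).
Proof.
elim: k => [|k IH] kn; first by rewrite inner0 big1 ?scaler0 ?subr0.
have := sum_ord_ltS (fun j => grad (f j) (inner x j)) (Ordinal kn) => /= ->.
have := innerS x (Ordinal kn) => /= ->.
by rewrite {1}IH 1?ltnW// scalerDr opprD addrA.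
Qed.

Lemma IG_epoch_sum x :
  IG_epoch f gamma x = x - gamma *: \sum_(j < n) grad (f j) (inner x j).
Proof.
rewrite -inner_epoch inner_sum//; congr (_ - _ *: _).
by apply: eq_bigl => j; rewrite ltn_ord.
Qed.

Lemma IGS x0 t : IG f gamma x0 t.+1 = IG_epoch f gamma (IG f gamma x0 t).
Proof. by []. Qed.

End InnerIterates.

(** * Scalar recursions *)

Section ScalarRecursions.
Context {R : realType}.

(** [E] is the fixed point of r -> q r + (1 - q) E, so the excess over [E] shrinks by q per step.
    This form composes: it serves both the inner steps and the epochs without accumulating noise. *)
Lemma contraction_iter (a : nat -> R) (q E : R) (N : nat) : 0 <= q ->
  (forall k, (k < N)%N -> a k.+1 <= q * a k + (1 - q) * E) ->
  a N <= q ^+ N * a 0 + (1 - q ^+ N) * E.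
Proof.
move=> q0; elim: N => [|N IH] aq; first by rewrite expr0; lra.
have := aq N (ltnSn N).
have /(ler_wpM2l q0) := IH (fun k kN => aq k (ltnW kN)).
by rewrite exprS; lra.
Qed.

Lemma bernoulli_sub (x : R) (N : nat) : 0 <= x <= 1 -> 1 - N%:R * x <= (1 - x) ^+ N.
Proof.
move=> /andP[x0 x1]; elim: N => [|N IH]; first by rewrite expr0; lra.
rewrite exprS -natr1.
have : (1 - x) * (1 - N%:R * x) <= (1 - x) * (1 - x) ^+ N.
  by rewrite ler_wpM2l// subr_ge0.
have : 0 <= N%:R * (x * x) by rewrite !mulr_ge0.
lra.
Qed.

End ScalarRecursions.

(** * One epoch *)

Lemma smooth_sqr {R : realType} {d : nat} (L : R) (phi : 'rV[R]_d -> R) x y :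
  smooth L phi ->
  dot (grad phi x - grad phi y) (grad phi x - grad phi y)
  <= L ^+ 2 * dot (x - y) (x - y).
Proof.
move=> Lphi; rewrite -!enorm_sqr -exprMn lerXn2r ?nnegrE ?enorm_ge0//.
exact: le_trans (enorm_ge0 _) (Lphi x y).
Qed.

(** The function lies between quadratics of curvature [mu] and [L] with the same tangent at 0; a
    positive dimension supplies a nonzero vector at which to compare them. *)
Lemma strongly_convex_le_smooth {R : realType} {d : nat} (L mu : R)
    (phi : 'rV[R]_d -> R) :
  (0 < d)%N -> 0 <= L -> (forall z, differentiable phi z) -> smooth L phi ->
  strongly_convex mu phi -> mu <= L.
Proof.
move=> d0 L0 dphi Lphi cphi.
pose v : 'rV[R]_d := const_mx 1.
have := strongly_convex_ge 0 v L0 dphi Lphi cphi.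
have := smooth_upper 0 v dphi Lphi.
have v0 : 0 < dot (v - 0) (v - 0).
  rewrite subr0 /dot; under eq_bigr do rewrite mxE mul1r.
  by rewrite sumr_const card_ord ltr0n.
move=> H1 /le_trans/(_ H1) H2.
suff : mu / 2 <= L / 2 by lra.
rewrite -(ler_pM2r v0); lra.
Qed.

Section Epochs.
Context {R : realType} {d n : nat}.
Variables (f : 'I_n -> 'rV[R]_d -> R) (L : R).
Hypothesis n_gt0 : (0 < n)%N.
Hypothesis L_gt0 : 0 < L.
Hypothesis df : forall i x, differentiable (f i) x.
Hypothesis Lf : forall i, smooth L (f i).

Section ShiftedOptimum.
Variables (mu gamma : R) (xs : 'rV[R]_d).
Hypothesis mu_gt0 : 0 < mu.
Hypothesis gamma_gt0 : 0 < gamma.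
Hypothesis gammaL : gamma * L <= 1.
Hypothesis gammamu : gamma * mu <= 1.
Hypothesis cf : forall i, strongly_convex mu (f i).
Hypothesis xs_min : grad (favg f) xs = 0.

(** With D the Bregman divergence of f_i, <w, y - z> = D(z, y) + D(y, xs) - D(z, xs). Strong
    convexity bounds D(z, y) below by (mu / 2) |y - z|^2, cocoercivity and gamma L <= 1 absorb
    gamma^2 |w|^2 into 2 gamma D(y, xs), and smoothness bounds D(z, xs) above by (L / 2) |z -
    xs|^2. *)
Lemma gradient_step_contraction i y z :
  dot (y - gamma *: grad (f i) y - (z - gamma *: grad (f i) xs))
      (y - gamma *: grad (f i) y - (z - gamma *: grad (f i) xs))
  <= (1 - gamma * mu) * dot (y - z) (y - z)
     + gamma * L * dot (z - xs) (z - xs).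
Proof.
set w := grad (f i) y - grad (f i) xs.
have -> : y - gamma *: grad (f i) y - (z - gamma *: grad (f i) xs)
    = (y - z) - gamma *: w.
  by apply/rowP => j; rewrite !mxE; ring.
have -> : dot ((y - z) - gamma *: w) ((y - z) - gamma *: w)
    = dot (y - z) (y - z) - 2 * gamma * dot w (y - z) + gamma ^+ 2 * dot w w.
  by rewrite !(dotDl _ (- (gamma *: w)), dotDr _ (- (gamma *: w))) !dotNl !dotNr
    !dotZl !dotZr [dot (y - z) w]dotC; ring.
have H1 := strongly_convex_ge y z (ltW L_gt0) (df i) (Lf i) (cf i).
have H2 := cocoercive y xs L_gt0 (df i) (Lf i) (strongly_convexW (ltW mu_gt0) (cf i)).
have H3 := smooth_upper xs z (df i) (Lf i).
set D := f i y - f i xs - dot (grad (f i) xs) (y - xs) in H2.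
have D0 : 0 <= D.
  have : 0 <= 2 * L * D := le_trans (dot_ge0 _) H2.
  by rewrite pmulr_rge0// mulr_gt0.
have {H2}H2 : gamma ^+ 2 * dot w w <= 2 * gamma * D.
  apply: le_trans (ler_wpM2l (sqr_ge0 gamma) H2) _.
  have -> : gamma ^+ 2 * (2 * L * D) = 2 * gamma * ((gamma * L) * D) by ring.
  by rewrite ler_pM2l ?mulr_gt0// ler_piMl.
have H4 := ler_wpM2l (ltW gamma_gt0) (le_trans H1 H3).
have Ez : dot (z - y) (z - y) = dot (y - z) (y - z).
  by rewrite -opprB dotNl dotNr opprK.
have Ew : dot w (y - z) = dot (grad (f i) y) y - dot (grad (f i) y) z
    - (dot (grad (f i) xs) y - dot (grad (f i) xs) z) by rewrite !dotE; ring.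
move: H4 H2; rewrite /D Ez Ew ![dot (grad _ _) (_ - _)]dotDr !dotNr; lra.
Qed.

Lemma inner_contraction x :
  dot (IG_epoch f gamma x - xs) (IG_epoch f gamma x - xs)
  <= (1 - gamma * mu) ^+ n * dot (x - xs) (x - xs)
     + (1 - (1 - gamma * mu) ^+ n)
       * (gamma ^+ 2 * L * n%:R ^+ 2 * sigma_star f xs ^+ 2 / mu).
Proof.
set E := _ / mu.
pose z k := xs - gamma *: \sum_(j < n | (j < k)%N) grad (f j) xs.
pose a k := dot (inner f gamma x k - z k) (inner f gamma x k - z k).
have a0 : a 0%N = dot (x - xs) (x - xs).
  by rewrite /a /z inner0 big1// scaler0 subr0.
have an : a n = dot (IG_epoch f gamma x - xs) (IG_epoch f gamma x - xs).
  rewrite /a /z inner_epoch; under eq_bigl do rewrite ltn_ord.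
  by rewrite sum_grad// xs_min !scaler0 subr0.
rewrite -a0 -an; apply: contraction_iter; first by rewrite subr_ge0.
move=> k kn; rewrite /a.
have -> : z k.+1 = z k - gamma *: grad (f (Ordinal kn)) xs.
  have := sum_ord_ltS (fun j => grad (f j) xs) (Ordinal kn) => /= S.
  by rewrite /z S scalerDr opprD addrA.
have := innerS f gamma x (Ordinal kn) => /= ->.
apply: le_trans (gradient_step_contraction _ _ _) _; rewrite lerD2l.
(* [E] is scaled so that (1 - q) E is gamma L times gamma^2 n^2 sigma^2, a uniform bound on |z_k -
   xs|^2. *)
have -> : (1 - (1 - gamma * mu)) * E
    = gamma * L * (gamma ^+ 2 * (n%:R * (n%:R * sigma_star f xs ^+ 2))).
  by rewrite /E; field; rewrite gt_eqF.
rewrite ler_pM2l ?mulr_gt0//.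
have -> : z k - xs = - (gamma *: \sum_(j < n | (j < k)%N) grad (f j) xs).
  by rewrite /z addrAC subrr sub0r.
rewrite dotNl dotNr opprK dotZl dotZr mulrA -expr2.
rewrite ler_wpM2l ?sqr_ge0// sigma_star_sqr//.
apply: le_trans (dot_sum_head_le _ _) _.
by rewrite ler_wpM2r ?ler_nat 1?ltnW// sumr_ge0// => *; exact: dot_ge0.
Qed.

Lemma IG_strongly_convex_components x0 T :
  enorm (IG f gamma x0 T - xs) ^+ 2 <=
    (1 - gamma * mu) ^+ (n * T) * enorm (x0 - xs) ^+ 2
    + gamma ^+ 2 * L * n%:R ^+ 2 * sigma_star f xs ^+ 2 / mu.
Proof.
set E := _ / mu; set q := 1 - gamma * mu.
have q0 : 0 <= q by rewrite subr_ge0.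
have E0 : 0 <= E by rewrite !(sqr_ge0, invr_ge0, mulr_ge0) ?ltW.
pose a t := enorm (IG f gamma x0 t - xs) ^+ 2.
have aS t : (t < T)%N -> a t.+1 <= q ^+ n * a t + (1 - q ^+ n) * E.
  by move=> _; rewrite /a !enorm_sqr; exact: inner_contraction.
rewrite exprM; apply: le_trans (contraction_iter (exprn_ge0 _ q0) aS) _.
by rewrite lerD2l ler_piMl// gerBl !exprn_ge0.
Qed.

End ShiftedOptimum.

(** * Convex components: an epoch as an implicit gradient step *)

Section ConvexEpoch.
Variables (gamma : R) (xs : 'rV[R]_d).
Hypothesis gamma_gt0 : 0 < gamma.
Hypothesis gammaL : 2 * (gamma * n%:R * L) ^+ 2 <= 1.
Hypothesis cf : forall i, convex (f i).
Hypothesis xs_min : grad (favg f) xs = 0.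
Let sigma := sigma_star f xs.

Lemma convex_epoch x (x' := IG_epoch f gamma x) :
  dot (x' - xs) (x' - xs) <= dot (x - xs) (x - xs)
    - 2 * gamma * n%:R * (favg f x' - favg f xs)
    + gamma ^+ 3 * L * n%:R ^+ 3 * sigma ^+ 2.
Proof.
pose y (j : 'I_n) := inner f gamma x j.
pose G j := grad (f j) (y j).
pose g j := grad (f j) xs.
pose S := \sum_(j < n) G j.
pose W := \sum_(j < n) dot (G j - g j) (G j - g j).
pose V := \sum_(j < n) dot (x' - y j) (x' - y j).
have x'E : x' = x - gamma *: S by rewrite /x' IG_epoch_sum.
have W0 : 0 <= W by apply: sumr_ge0 => *; exact: dot_ge0.
(* For each j, cocoercivity relates f_j at xs and y_j, and the descent lemma relates it at y_j and
   x'; f_j(y_j) cancels in the sum. *)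
have inner_prod : W + 2 * L * (n%:R * (favg f x' - favg f xs))
    <= 2 * L * dot S (x' - xs) + L ^+ 2 * V.
  rewrite mulrBr -!sum_favg// /S dot_suml -sumrB !mulr_sumr -!big_split/=.
  apply: ler_sum => j _.
  have := cocoercive xs (y j) L_gt0 (df j) (Lf j) (cf j).
  have := ler_wpM2l (ltW L_gt0) (smooth_upper (y j) x' (df j) (Lf j)).
  rewrite -/(G j) -/(g j) -[g j - _]opprB dotNl dotNr opprK.
  rewrite ![dot (G j) (_ - _)]dotDr !dotNr; lra.
(* The remaining steps use the tail of the G_k. Since the g_k sum to zero, their tail is minus their
   head: subtracting it leaves differences G_k - g_k, controlled by [W], and a head of g_k, which
   yields the noise. *)
have tailE j : x' - y j = - (gamma *: (\sum_(k < n | ~~ (k < j)%N) (G k - g k)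
                              - \sum_(k < n | (k < j)%N) g k)).
  have -> : \sum_(k < n | ~~ (k < j)%N) (G k - g k)
              - \sum_(k < n | (k < j)%N) g k = \sum_(k < n | ~~ (k < j)%N) G k.
    rewrite sumrB -addrA -opprD [X in _ - X]addrC.
    rewrite -(bigID (fun k : 'I_n => (k < j)%N) xpredT g)/=.
    by rewrite sum_grad// xs_min scaler0 subr0.
  rewrite x'E /y inner_sum ?(ltnW (ltn_ord j))//.
  rewrite /S (bigID (fun k : 'I_n => (k < j)%N))/=.
  by apply/rowP => k; rewrite !mxE; ring.
have V_le : V <= gamma ^+ 2 * n%:R ^+ 2 * (2 * W + n%:R * sigma ^+ 2).
  rewrite sigma_star_sqr//.
  have := sum_dot_sum_tail_le (fun k => G k - g k).
  have := sum_dot_sum_head_le g; rewrite -/W.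
  set a := \sum_(i < n) dot (\sum_(j < n | _) g j) _.
  set b := \sum_(i < n) dot (\sum_(j < n | _) _) _.
  move=> ale ble.
  have : V <= gamma ^+ 2 * (2 * b + 2 * a).
    rewrite /a /b !mulr_sumr -!big_split/= mulr_sumr; apply: ler_sum => j _.
    rewrite tailE dotNl dotNr opprK dotZl dotZr mulrA -expr2 ler_wpM2l ?sqr_ge0//.
    apply: le_trans (dotDD_le _ _) _.
    by rewrite dotNl dotNr opprK.
  move/le_trans; apply.
  by rewrite -mulrA ler_wpM2l ?sqr_ge0//; lra.
have -> : dot (x - xs) (x - xs) = dot (x' - xs) (x' - xs)
     + 2 * gamma * dot S (x' - xs) + gamma ^+ 2 * dot S S.
  have -> : x - xs = (x' - xs) + gamma *: S by rewrite x'E [RHS]addrAC subrK.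
  by rewrite !(dotDl _ (gamma *: S), dotDr _ (gamma *: S))
    !dotZl !dotZr [dot (x' - xs) S]dotC; ring.
suff : 2 * gamma * (n%:R * (favg f x' - favg f xs))
    <= 2 * gamma * dot S (x' - xs) + gamma ^+ 3 * L * n%:R ^+ 3 * sigma ^+ 2.
  by have := mulr_ge0 (sqr_ge0 gamma) (dot_ge0 S); lra.
rewrite -(ler_pM2l L_gt0).
have H1 := ler_wpM2l (ltW gamma_gt0) inner_prod.
(* The restriction 2 (gamma n L)^2 <= 1 is exactly what turns the [W] part of the bound on L^2 V
   into a single [W], to be cancelled against [inner_prod]. *)
have H2 : gamma * (L ^+ 2 * V)
   <= gamma * W + gamma ^+ 3 * L ^+ 2 * n%:R ^+ 3 * sigma ^+ 2.
  have -> : gamma ^+ 3 * L ^+ 2 * n%:R ^+ 3 * sigma ^+ 2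
    = gamma * (gamma ^+ 2 * L ^+ 2 * n%:R ^+ 3 * sigma ^+ 2) by ring.
  rewrite -mulrDr ler_pM2l//.
  apply: le_trans (ler_wpM2l (sqr_ge0 L) V_le) _.
  by have := ler_wpM2r W0 gammaL; lra.
lra.
Qed.

End ConvexEpoch.

(** * Non-convex components: forward drift and descent *)

Section NonconvexEpoch.
Variables (gamma : R) (x : 'rV[R]_d).
Hypothesis gamma_gt0 : 0 < gamma.
Hypothesis gammaL : 8 * (gamma * n%:R * L) ^+ 2 <= 1.
Hypothesis Lfavg : smooth L (favg f).
Let G := grad (favg f) x.

(** A self-bounding estimate: each gradient used is split into its deviation from the gradient at x,
    the component deviation from [G], and [G]. The first part returns [V] with coefficient (gamma n
    L)^2 <= 1 / 8; moving it to the left turns the constant 2 into 16 / 7. *)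
Lemma inner_drift s :
  \sum_(i < n) dot (grad (f i) x - G) (grad (f i) x - G) <= n%:R * s ->
  \sum_(i < n) dot (inner f gamma x i - x) (inner f gamma x i - x)
  <= 16 / 7 * gamma ^+ 2 * n%:R ^+ 3 * (s + dot G G).
Proof.
move=> s_ge; set V := \sum_(i < n) _.
have V0 : 0 <= V by apply: sumr_ge0 => *; exact: dot_ge0.
pose F (j : 'I_n) := grad (f j) (inner f gamma x j).
have F_le : \sum_(j < n) dot (F j) (F j)
    <= 2 * L ^+ 2 * V + 4 * (n%:R * s) + 4 * n%:R * dot G G.
  have -> : 4 * n%:R * dot G G = \sum_(j < n) 4 * dot G G.
    by rewrite sumr_const card_ord -[RHS]mulr_natl; ring.
  apply: (@le_trans _ _ (2 * L ^+ 2 * V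
     + 4 * (\sum_(i < n) dot (grad (f i) x - G) (grad (f i) x - G))
     + \sum_(j < n) 4 * dot G G)).
    rewrite 2!mulr_sumr -!big_split/=; apply: ler_sum => j _.
    have := dotDD_le (F j - grad (f j) x) (grad (f j) x).
    have := dotDD_le (grad (f j) x - G) G.
    have := smooth_sqr (inner f gamma x j) x (Lf j); rewrite -/(F j).
    rewrite !subrK. lra.
  by rewrite lerD2r lerD2l ler_pM2l.
have V_le : V <= gamma ^+ 2 * (n%:R ^+ 2 / 2 * \sum_(j < n) dot (F j) (F j)).
  apply: le_trans (ler_wpM2l (sqr_ge0 gamma) (sum_dot_sum_head_le F)).
  rewrite mulr_sumr; apply: ler_sum => i _.
  rewrite inner_sum ?(ltnW (ltn_ord i))// addrAC subrr sub0r.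
  by rewrite dotNl dotNr opprK dotZl dotZr mulrA -expr2.
have := ler_wpM2l (mulr_ge0 (sqr_ge0 gamma) (sqr_ge0 n%:R)) F_le.
have := ler_wpM2r V0 gammaL; lra.
Qed.

(** Polarization writes -2 n <G, S> as |n G - S|^2 - n^2 |G|^2 - |S|^2. The term in |S|^2 cancels
    the quadratic term of the descent lemma because gamma n L <= 1, and |n G - S|^2 is bounded by
    the drift. *)
Lemma nonconvex_epoch s :
  \sum_(i < n) dot (grad (f i) x - G) (grad (f i) x - G) <= n%:R * s ->
  favg f (IG_epoch f gamma x) <= favg f x - 5 / 14 * (gamma * n%:R) * dot G G
    + 8 / 7 * gamma ^+ 3 * L ^+ 2 * n%:R ^+ 3 * s.
Proof.
move=> /inner_drift; set V := \sum_(i < n) _ => V_le.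
have n0 : 0 < n%:R :> R by rewrite ltr0n.
have u0 : 0 < gamma * n%:R * L by rewrite !mulr_gt0.
have u1 : gamma * n%:R * L <= 1.
  rewrite -(@expr_le1 _ 2) ?(ltW u0)//.
  by have := sqr_ge0 (gamma * n%:R * L); have := gammaL; lra.
pose S := \sum_(j < n) grad (f j) (inner f gamma x j).
have diffS : dot (n%:R *: G - S) (n%:R *: G - S) <= n%:R * (L ^+ 2 * V).
  rewrite -sum_grad// -sumrB; apply: le_trans (dot_sum_le _ _) _.
  rewrite card_ord ler_pM2l// mulr_sumr; apply: ler_sum => j _.
  apply: le_trans (smooth_sqr _ _ (Lf j)) _.
  by rewrite -[x - _]opprB dotNl dotNr opprK.
have := smooth_upper x (IG_epoch f gamma x)
  (fun z => differentiable_favg (fun i => df i z)) Lfavg.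
rewrite -/G IG_epoch_sum -/S [x - _ - x]addrAC subrr sub0r.
rewrite !dotNl !dotNr opprK !dotZl !dotZr => /le_trans; apply.
rewrite -(ler_pM2l n0).
have S_le : gamma * (gamma * n%:R * L) * dot S S <= gamma * dot S S.
  by rewrite ler_wpM2r ?dot_ge0// ler_piMr// ltW.
have := ler_wpM2l (ltW gamma_gt0) diffS.
rewrite !(dotDl, dotDr) !dotNl !dotNr !dotZl !dotZr [dot S G]dotC opprK.
have := ler_wpM2l (mulr_ge0 (ltW (mulr_gt0 gamma_gt0 n0)) (sqr_ge0 L)) V_le.
(* The drift returns at most 1 / 7 of gamma n |G|^2, whence 5 / 14 = 1 / 2 - 1 / 7. *)
have G_le : gamma * n%:R ^+ 2 * dot G G * (8 * (gamma * n%:R * L) ^+ 2)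
   <= gamma * n%:R ^+ 2 * dot G G.
  by rewrite ler_piMr// !mulr_ge0 ?sqr_ge0 ?dot_ge0// ltW.
lra.
Qed.

End NonconvexEpoch.

End Epochs.

(** * Convergence over T epochs *)

Section Trajectories.
Context {R : realType} {d n : nat}.
Variables (f : 'I_n -> 'rV[R]_d -> R) (L : R).
Hypothesis n_gt0 : (0 < n)%N.
Hypothesis L_gt0 : 0 < L.
Hypothesis df : forall i x, differentiable (f i) x.
Hypothesis Lf : forall i, smooth L (f i).
Hypothesis Lfavg : smooth L (favg f).

Let nR_gt0 : 0 < n%:R :> R. Proof. by rewrite ltr0n. Qed.
Let dfavg x : differentiable (favg f) x.
Proof. by apply: differentiable_favg => i; exact: df. Qed.

(** * Convex components over T epochs *)

Section Convex.
Variables (gamma : R) (xs x0 : 'rV[R]_d).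
Hypothesis gamma_gt0 : 0 < gamma.
Hypothesis gammaL : 2 * (gamma * n%:R * L) ^+ 2 <= 1.
Hypothesis cf : forall i, convex (f i).
Hypothesis xs_min : grad (favg f) xs = 0.
Let sigma := sigma_star f xs.

Lemma IG_strongly_convex_average (mu : R) T : 0 < mu -> mu <= L ->
  strongly_convex mu (favg f) ->
  enorm (IG f gamma x0 T - xs) ^+ 2 <=
    (1 - gamma * mu * n%:R / 2) ^+ T * enorm (x0 - xs) ^+ 2
    + 2 * gamma ^+ 2 * (L / mu) * n%:R ^+ 2 * sigma ^+ 2.
Proof.
move=> mu0 muL cfavg; set E := _ * sigma ^+ 2.
pose a := gamma * n%:R * mu; have a0 : 0 < a by rewrite !mulr_gt0.
have a1 : a <= 1.
  have aL : a <= gamma * n%:R * L by rewrite ler_pM2l// mulr_gt0.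
  apply: le_trans aL _; have u0 : 0 < gamma * n%:R * L by rewrite !mulr_gt0.
  rewrite -(@expr_le1 _ 2) ?(ltW u0)//.
  by have := sqr_ge0 (gamma * n%:R * L); have := gammaL; lra.
have -> : gamma * mu * n%:R / 2 = a / 2 by rewrite /a; ring.
have q0 : 0 <= 1 - a / 2 by lra.
have E0 : 0 <= E.
  by rewrite !(sqr_ge0, mulr_ge0)// ?(ltW L_gt0)// invr_ge0 ltW.
pose r t := enorm (IG f gamma x0 t - xs) ^+ 2.
have rS t : (t < T)%N -> r t.+1 <= (1 - a / 2) * r t + (1 - (1 - a / 2)) * E.
  move=> _; rewrite /r !enorm_sqr IGS; set x := IG f gamma x0 t.
  have := convex_epoch n_gt0 L_gt0 df Lf gamma_gt0 gammaL cf xs_min x => /=.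
  have := strongly_convex_ge xs (IG_epoch f gamma x) (ltW L_gt0) dfavg Lfavg cfavg.
  rewrite xs_min dot0l addr0; set x' := IG_epoch f gamma x => H1 H2.
  have e0 : 0 <= gamma ^+ 3 * L * n%:R ^+ 3 * sigma ^+ 2.
    by rewrite !(sqr_ge0, mulr_ge0)// ?exprn_ge0// ltW.
  have H3 : (1 + a) * dot (x' - xs) (x' - xs) <= dot (x - xs) (x - xs)
      + gamma ^+ 3 * L * n%:R ^+ 3 * sigma ^+ 2.
    have g2 : 0 <= 2 * (gamma * n%:R) by rewrite !mulr_ge0 ?ltW.
    have := ler_wpM2l g2 H1; rewrite /a; move: H2; rewrite -/sigma; lra.
  (* [E] is chosen so that (a / 2) E is the noise added by one epoch. *)
  have -> : (1 - (1 - a / 2)) * E = gamma ^+ 3 * L * n%:R ^+ 3 * sigma ^+ 2.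
    by rewrite /E /a; field; rewrite gt_eqF.
  have H4 := ler_wpM2l q0 H3.
  (* For 0 <= a <= 1 one has (1 - a / 2) (1 + a) >= 1, so the implicit factor 1 / (1 + a) is at most
     1 - a / 2. *)
  have H5 : dot (x' - xs) (x' - xs)
      <= (1 - a / 2) * ((1 + a) * dot (x' - xs) (x' - xs)).
    rewrite mulrA ler_peMl ?dot_ge0//.
    by have := ler_wpM2l (ltW a0) a1; lra.
  have H6 : 0 <= a / 2 * (gamma ^+ 3 * L * n%:R ^+ 3 * sigma ^+ 2).
    by rewrite mulr_ge0//; lra.
  lra.
apply: le_trans (contraction_iter q0 rS) _.
by rewrite lerD2l ler_piMl// gerBl exprn_ge0.
Qed.

(** Jensen's inequality: sum the tangent plane bounds at the average; their linear terms cancel. *)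
Lemma jensen_favg (x : nat -> 'rV[R]_d) T : (0 < T)%N ->
  T%:R * favg f (T%:R^-1 *: \sum_(1 <= t < T.+1) x t)
  <= \sum_(1 <= t < T.+1) favg f (x t).
Proof.
move=> T0; have TR : T%:R != 0 :> R by rewrite pnatr_eq0 -lt0n.
set xh := _ *: _.
have /strongly_convex0 cfavg := convex_favg cf.
have : \sum_(1 <= t < T.+1) (favg f xh + dot (grad (favg f) xh) (x t - xh))
    <= \sum_(1 <= t < T.+1) favg f (x t).
  apply: ler_sum => t _.
  have := strongly_convex_ge xh (x t) (ltW L_gt0) dfavg Lfavg cfavg.
  by rewrite !mul0r addr0.
rewrite big_split/= sumr_const_nat subn1/=.
suff -> : \sum_(1 <= t < T.+1) dot (grad (favg f) xh) (x t - xh) = 0.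
  by rewrite addr0 -[leLHS]mulr_natl.
rewrite !big_add1/= !big_mkord -dot_sumr sumrB sumr_const card_ord.
rewrite -scaler_nat /xh scalerA divff// scale1r big_add1/= big_mkord subrr.
by rewrite dotC dot0l.
Qed.

Lemma IG_convex_average T : (0 < T)%N ->
  favg f (IG_avg f gamma x0 T) - favg f xs <=
    enorm (x0 - xs) ^+ 2 / (2 * gamma * n%:R * T%:R)
    + gamma ^+ 2 * L * n%:R ^+ 2 * sigma ^+ 2 / 2.
Proof.
move=> T0; have TR : 0 < T%:R :> R by rewrite ltr0n.
pose e := gamma ^+ 3 * L * n%:R ^+ 3 * sigma ^+ 2.
pose r t := dot (IG f gamma x0 t - xs) (IG f gamma x0 t - xs).
(* Telescoping. [convex_epoch] evaluates the objective at the end of an epoch, hence the indices 1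
   to T. *)
have sum_le : r T + 2 * gamma * n%:R
      * (\sum_(1 <= t < T.+1) favg f (IG f gamma x0 t) - T%:R * favg f xs)
    <= r 0%N + T%:R * e.
  elim: {T0 TR} T => [|T IH]; first by rewrite big_geq//; lra.
  rewrite big_nat_recr//= -natr1.
  have := convex_epoch n_gt0 L_gt0 df Lf gamma_gt0 gammaL cf xs_min
    (IG f gamma x0 T) => /=.
  by rewrite -IGS -/(r T.+1) -/(r T) -/sigma -/e; lra.
have k0 : 0 < 2 * gamma * n%:R by rewrite !mulr_gt0.
have := ler_wpM2l (ltW k0) (jensen_favg (IG f gamma x0) T0).
rewrite -/(IG_avg f gamma x0 T) => J.
have rT0 : 0 <= r T := dot_ge0 _.
rewrite -(ler_pM2l (mulr_gt0 k0 TR)).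
have -> : 2 * gamma * n%:R * T%:R *
   (enorm (x0 - xs) ^+ 2 / (2 * gamma * n%:R * T%:R) +
    gamma ^+ 2 * L * n%:R ^+ 2 * sigma ^+ 2 / 2) = r 0%N + T%:R * e.
  by rewrite enorm_sqr /e /r; field; rewrite !gt_eqF.
lra.
Qed.

End Convex.

(** * Non-convex components over T epochs *)

Section Nonconvex.
Variables (gamma A B fstar : R) (x0 : 'rV[R]_d).
Hypothesis gamma_gt0 : 0 < gamma.
Hypothesis gammaL : 8 * (gamma * n%:R * L) ^+ 2 <= 1.
Hypothesis A_ge0 : 0 <= A.
Hypothesis fstar_le : forall x, fstar <= favg f x.
Hypothesis variance_le : forall x, n%:R^-1 * \sum_(i < n)
    enorm (grad (f i) x - grad (favg f) x) ^+ 2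
  <= 2 * A * (favg f x - fstar) + B ^+ 2.

(** Stating the bound for an arbitrary lower bound [m] on the squared gradient norms serves both the
    minimum over epochs and the argument by contradiction for the target accuracy. *)
Lemma IG_nonconvex_le T m : (0 < T)%N ->
  gamma ^+ 3 * (4 * L ^+ 2 * n%:R ^+ 3 * A * T%:R) <= 1 ->
  (forall t, (t < T)%N -> m <= enorm (grad (favg f) (IG f gamma x0 t)) ^+ 2) ->
  m <= 12 * (favg f x0 - fstar) / (gamma * n%:R * T%:R)
       + 8 * gamma ^+ 2 * L ^+ 2 * n%:R ^+ 2 * B ^+ 2.
Proof.
move=> T0 gammaA m_le; have TR : 0 < T%:R :> R by rewrite ltr0n.
pose a := 16 / 7 * gamma ^+ 3 * L ^+ 2 * n%:R ^+ 3 * A.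
pose b := 5 / 14 * (gamma * n%:R).
pose c := 8 / 7 * gamma ^+ 3 * L ^+ 2 * n%:R ^+ 3 * B ^+ 2.
pose D t := favg f (IG f gamma x0 t) - fstar.
have D0 t : 0 <= D t by rewrite subr_ge0.
have a0 : 0 <= a by rewrite !mulr_ge0 ?exprn_ge0 ?(ltW gamma_gt0) ?(ltW L_gt0).
have aT : T%:R * a <= 4 / 7 by rewrite /a; lra.
have b0 : 0 < b by rewrite !mulr_gt0.
have bT0 : 0 < gamma * n%:R * T%:R by rewrite !mulr_gt0.
have F1 : 0 <= (favg f x0 - fstar) / (gamma * n%:R * T%:R).
  by rewrite divr_ge0 ?subr_ge0// ltW.
have cE : c = b * (16 / 5 * gamma ^+ 2 * L ^+ 2 * n%:R ^+ 2 * B ^+ 2).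
  by rewrite /c /b; field.
have F2 : 0 <= gamma ^+ 2 * L ^+ 2 * n%:R ^+ 2 * B ^+ 2.
  by rewrite !(sqr_ge0, mulr_ge0).
have DS t : (t < T)%N -> D t.+1 <= (1 + a) * D t - (b * m - c).
  move=> tT; rewrite /D IGS; set x := IG f gamma x0 t.
  have /(nonconvex_epoch n_gt0 L_gt0 df Lf gamma_gt0 gammaL Lfavg) :
      \sum_(i < n) dot (grad (f i) x - grad (favg f) x)
                       (grad (f i) x - grad (favg f) x)
      <= n%:R * (2 * A * (favg f x - fstar) + B ^+ 2).
    rewrite -ler_pdivrMl//; under eq_bigr do rewrite -enorm_sqr.
    exact: variance_le.
  have := ler_wpM2l (ltW b0) (m_le _ tT); rewrite enorm_sqr -/x /a /b /c; lra.
(* If b m <= c, the noise alone bounds m by c / b. Otherwise b m - c is positive, and the recursion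
   may drop its amplification by 1 + a. *)
have [bm|bm] := leP (b * m) c.
  have : m <= 16 / 5 * gamma ^+ 2 * L ^+ 2 * n%:R ^+ 2 * B ^+ 2.
    by rewrite -(ler_pM2l b0) -cE.
  lra.
have Dt t : (t <= T)%N -> D t <= (1 + a) ^+ t * D 0%N - t%:R * (b * m - c).
  elim: t => [_|t IH tT]; first by rewrite expr0; lra.
  apply: le_trans (DS _ tT) _; rewrite exprS -natr1.
  have p0 : 0 <= 1 + a by lra.
  have := ler_wpM2l p0 (IH (ltnW tT)).
  have : 0 <= a * (t%:R * (b * m - c)) by rewrite mulr_ge0// mulr_ge0// subr_ge0 ltW.
  lra.
(* (1 + a)^T (1 - a)^T <= 1, while Bernoulli gives (1 - a)^T >= 1 - T a >= 3 / 7; hence (1 + a)^T <=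
   7 / 3. *)
have growth : (1 + a) ^+ T <= 3.
  have a1 : a <= 1.
    by apply: le_trans (_ : T%:R * a <= 1); [rewrite ler_peMl// ler1n|lra].
  have := @bernoulli_sub _ a T; rewrite a0 a1 => /(_ isT) B1.
  have pT : 0 <= (1 + a) ^+ T by rewrite exprn_ge0//; lra.
  have : (1 + a) ^+ T * (1 - a) ^+ T <= 1.
    rewrite -exprMn exprn_ile1//; first by rewrite mulr_ge0; lra.
    by have := mulr_ge0 a0 a0; lra.
  have B2 : 3 / 7 <= (1 - a) ^+ T by lra.
  by have := ler_wpM2l pT B2; lra.
have := Dt T (leqnn T) => H1.
have H2 := ler_wpM2r (D0 0%N) growth.
have H3 : T%:R * (b * m - c) <= 3 * D 0%N by have := D0 T; lra.
(* Dividing by T b gives 3 * 14 / 5 = 42 / 5 and c / b, both within the claimed constants 12 and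
   8. *)
have : m <= 42 / 5 * ((favg f x0 - fstar) / (gamma * n%:R * T%:R))
    + 16 / 5 * gamma ^+ 2 * L ^+ 2 * n%:R ^+ 2 * B ^+ 2.
  rewrite -(ler_pM2l (mulr_gt0 TR b0)).
  have -> : T%:R * b * (42 / 5 * ((favg f x0 - fstar) / (gamma * n%:R * T%:R))
    + 16 / 5 * gamma ^+ 2 * L ^+ 2 * n%:R ^+ 2 * B ^+ 2)
    = 3 * D 0%N + T%:R * c.
    by rewrite cE /b /D; field; rewrite !gt_eqF.
  lra.
lra.
Qed.

End Nonconvex.

End Trajectories.

(** * Stepsizes *)

Section Stepsizes.
Context {R : realType}.
Implicit Types (L A B mu gamma eps D sigma delta : R) (n T : nat).

Lemma sqrt8 : Num.sqrt 8 = 2 * Num.sqrt 2 :> R.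
Proof.
have -> : 8 = 2 ^+ 2 * 2 :> R by ring.
by rewrite sqrtrM ?sqr_ge0// sqrtr_sqr ger0_norm.
Qed.

Lemma sqrt2_le : Num.sqrt 2 <= 2 :> R.
Proof.
by rewrite -(@ler_pXn2r _ 2) ?nnegrE ?sqrtr_ge0// sqr_sqrtr//; lra.
Qed.

Lemma stepsize_sqr (c : R) L gamma n : 0 <= c -> 0 <= L -> 0 <= gamma ->
  gamma * (Num.sqrt c * n%:R * L) <= 1 -> c * (gamma * n%:R * L) ^+ 2 <= 1.
Proof.
move=> c0 L0 g0; have -> : c * (gamma * n%:R * L) ^+ 2
    = (gamma * (Num.sqrt c * n%:R * L)) ^+ 2.
  by rewrite !exprMn sqr_sqrtr//; ring.
by move=> H; rewrite exprn_ile1// !mulr_ge0// sqrtr_ge0.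
Qed.

Lemma ler_pdiv1 (x gamma : R) : 0 < x -> (gamma <= 1 / x) = (gamma * x <= 1).
Proof. by move=> x0; rewrite ler_pdivlMr. Qed.

(** The product form stays valid at x = 0, where the left bound is +oo and the right side reads 0 <=
    1. *)
Lemma lee_inver (x gamma : R) : 0 <= x ->
  (gamma%:E <= (x%:E)^-1)%E = (gamma * x <= 1).
Proof.
rewrite inver; case: eqVneq => [->|x0 x_ge0]; first by rewrite leey mulr0 ler01.
by rewrite lee_fin -[x^-1]div1r ler_pdivlMr// lt_neqAle eq_sym x0.
Qed.

Lemma cube_root (x : R) : 0 <= x -> (x `^ 3^-1) ^+ 3 = x.
Proof.
by move=> x0; rewrite -powR_mulrn ?powR_ge0// -powRrM mulVf// powRr1.
Qed.

Lemma nonconvex_step_maxP L A gamma n T :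
  0 <= L -> 0 <= A -> 0 <= gamma ->
  (gamma%:E <= nonconvex_step_max L A n T)%E
  <-> gamma * (Num.sqrt 8 * n%:R * L) <= 1
      /\ gamma ^+ 3 * (4 * L ^+ 2 * n%:R ^+ 3 * A * T%:R) <= 1.
Proof.
move=> L0 A0 g0; set X := 4 * _ * _ * _ * _.
have X0 : 0 <= X by rewrite !mulr_ge0 ?exprn_ge0.
rewrite /nonconvex_step_max le_min !lee_inver ?powR_ge0 ?mulr_ge0 ?sqrtr_ge0//.
have -> : (gamma * X `^ 3^-1 <= 1) = (gamma ^+ 3 * X <= 1).
  by rewrite -{2}(cube_root X0) -exprMn expr_le1// mulr_ge0// powR_ge0.
by split=> [/andP|[-> ->]].
Qed.

(** The stepsize is 1 / max(X, Y / s), also when Y = 0 and the second entry of the minimum is +oo.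
    The last inequality is the lower bound on gamma that the epoch count requires. *)
Lemma min_stepsizeP (X Y s gamma : R) : 0 < X -> 0 <= Y -> 0 < s ->
  gamma%:E = Order.min (1%:E / X%:E)%E (s%:E / Y%:E)%E ->
  [/\ 0 < gamma, gamma * X <= 1, gamma * Y <= s
    & 1 <= gamma * Num.max X (Y / s)].
Proof.
move=> X0 Y0 s0; rewrite !inver (gt_eqF X0).
case: eqVneq => [->|Yn0].
  rewrite gt0_muley ?lte_fin// min_l ?leey// -EFinM => -[->].
  by rewrite mul0r mulr0 (max_l (ltW X0)) divfK ?gt_eqF// lexx (ltW s0) divr_gt0.
have {Yn0}Y0 : 0 < Y by rewrite lt_neqAle eq_sym Yn0.
rewrite -!EFinM -EFin_min => -[->].
have [XY|XY] := leP (1 * X^-1) (s * Y^-1).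
  rewrite mul1r in XY *; split; rewrite ?invr_gt0 ?mulVf ?gt_eqF//.
  - by rewrite -ler_pdivlMr.
  - by rewrite ler_pdivlMl// mulr1 le_max lexx.
have sY : 0 < s / Y by rewrite divr_gt0.
split => //.
- by rewrite -ler_pdivlMr// ltW.
- by rewrite divfK// gt_eqF.
- rewrite -ler_pdivrMl// mulr1 invf_div le_max lexx orbT//.
Qed.

Lemma polylog1_ge L mu (nn : R) D sigma eps : 0 <= L -> 0 <= mu -> 0 <= nn ->
  0 <= D -> 0 <= sigma -> 0 < eps ->
  1 + ln (1 + D) + ln (1 + 1 / eps)
  <= polylog 1 [:: L; mu; nn; D; sigma; 1 / eps].
Proof.
move=> L0 mu0 nn0 D0 sigma0 eps0; rewrite /polylog expr1 !big_cons big_nil.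
have ln0 (x : R) : 0 <= x -> 0 <= ln (1 + x) by move=> ?; rewrite ln_ge0// lerDl.
have := ln0 _ L0; have := ln0 _ mu0; have := ln0 _ nn0; have := ln0 _ sigma0.
lra.
Qed.

(** (1 - x)^N <= exp(- x N) <= exp(- 2 s), and exp(s) >= 2 (1 + D) (1 + 1 / eps), whose square
    dominates 2 D^2 / eps. *)
Lemma contraction_le_half (x D eps : R) (N : nat) :
  0 <= x <= 1 -> 0 <= D -> 0 < eps ->
  2 * (1 + ln (1 + D) + ln (1 + 1 / eps)) <= x * N%:R ->
  (1 - x) ^+ N * D ^+ 2 <= eps / 2.
Proof.
move=> /andP[x0 x1] D0 eps0; set s := 1 + _ + _ => xN.
have ie0 : 0 < 1 / eps by rewrite divr_gt0.
have s_ge : 2 * (1 + D) * (1 + 1 / eps) <= expR s.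
  rewrite /s !expRD !lnK ?posrE; [|lra|lra].
  rewrite !ler_wpM2r//; [lra|lra|].
  by have := expR_ge1Dx (1 : R); lra.
have qN : (1 - x) ^+ N * expR s ^+ 2 <= 1.
  apply: (@le_trans _ _ (expR (- x) ^+ N * expR s ^+ 2)).
    rewrite ler_wpM2r ?sqr_ge0// lerXn2r ?nnegrE ?expR_ge0 ?subr_ge0//.
    exact: expR_ge1Dx.
  rewrite -!expRM_natl -expRD -[leRHS]expR0 ler_expR; lra.
have q0 : 0 <= (1 - x) ^+ N by rewrite exprn_ge0// subr_ge0.
have Dle : D ^+ 2 * (2 / eps) <= expR s ^+ 2.
  apply: le_trans (_ : (2 * (1 + D) * (1 + 1 / eps)) ^+ 2 <= _); last first.
    by rewrite lerXn2r ?nnegrE ?expR_ge0// !mulr_ge0//; lra.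
  rewrite !exprMn.
  have H1 : D ^+ 2 <= (1 + D) ^+ 2 by rewrite lerXn2r ?nnegrE//; lra.
  have H2 : 2 / eps <= 2 ^+ 2 * (1 + 1 / eps) ^+ 2.
    by have := sqr_ge0 (1 / eps); lra.
  have := ler_pM (sqr_ge0 D) (divr_ge0 (ler0n _ 2) (ltW eps0)) H1 H2; lra.
have := le_trans (ler_wpM2l q0 Dle) qN.
by rewrite mulrA mulrA ler_pdivrMr//; lra.
Qed.

(* The stepsize is 1 / max cL (4 sqrt kappa n sigma / sqrt eps); taking a maximum
   in the denominator covers sigma = 0 without a case distinction. *)
Lemma strongly_convex_stepsize (cL mu sigma eps kappa : R) n :
  0 < cL -> 0 < mu -> 0 <= sigma -> 0 < eps -> 0 <= kappa ->
  exists gamma, [/\ 0 < gamma, gamma * cL <= 1,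
    gamma ^+ 2 * kappa * n%:R ^+ 2 * sigma ^+ 2 <= eps / 16
    & 1 <= gamma * mu * (cL / mu
        + 4 * (Num.sqrt kappa * n%:R * sigma / (mu * Num.sqrt eps)))].
Proof.
move=> cL0 mu0 sigma0 eps0 kappa0.
have se0 : 0 < Num.sqrt eps by rewrite sqrtr_gt0.
pose Q := Num.sqrt kappa * n%:R * sigma / Num.sqrt eps.
have Q0 : 0 <= Q by rewrite !mulr_ge0// ?sqrtr_ge0// invr_ge0 ltW.
pose M := Num.max cL (4 * Q).
have M0 : 0 < M by rewrite lt_max cL0.
have gQ : M^-1 * (4 * Q) <= 1 by rewrite ler_pdivrMl// mulr1 le_max lexx orbT.
exists M^-1; split.
- by rewrite invr_gt0.
- by rewrite ler_pdivrMl// mulr1 le_max lexx.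
- have -> : M^-1 ^+ 2 * kappa * n%:R ^+ 2 * sigma ^+ 2
      = (M^-1 * (4 * Q)) ^+ 2 * (eps / 16).
    rewrite -{1}(sqr_sqrtr kappa0) -[X in _ = _ * (X / 16)](sqr_sqrtr (ltW eps0)) /Q.
    by field; rewrite !gt_eqF.
  rewrite ler_piMl ?divr_ge0 ?(ltW eps0)// exprn_ile1//.
  by rewrite mulr_ge0 ?invr_ge0 ?(ltW M0)// mulr_ge0.
- have -> : M^-1 * mu * (cL / mu
        + 4 * (Num.sqrt kappa * n%:R * sigma / (mu * Num.sqrt eps)))
      = M^-1 * (cL + 4 * Q).
    by rewrite /Q; field; rewrite !gt_eqF.
  by rewrite ler_pdivlMl// mulr1 ge_max lerDl lerDr mulr_ge0// ltW.
Qed.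

Lemma nonconvex_stepsize L A B eps delta n T :
  0 < L -> 0 <= A -> 0 <= B -> 0 < eps -> 0 <= delta -> (0 < n)%N -> (0 < T)%N ->
  48 * delta * L * n%:R / eps ^+ 2
    * Num.max (Num.sqrt 2)
        (Num.max (Num.sqrt (24 * delta * A) / eps) (2 * B / eps))
    < (n * T)%:R ->
  exists gamma, [/\ 0 < gamma, gamma * (Num.sqrt 8 * n%:R * L) <= 1,
    gamma ^+ 3 * (4 * L ^+ 2 * n%:R ^+ 3 * A * T%:R) <= 1
    & 12 * delta / (gamma * n%:R * T%:R)
      + 8 * gamma ^+ 2 * L ^+ 2 * n%:R ^+ 2 * B ^+ 2 < eps ^+ 2].
Proof.
move=> L0 A0 B0 eps0 delta0 n0 T0; set mx := Num.max _ _.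
have nR : 0 < n%:R :> R by rewrite ltr0n.
have TR : 0 < T%:R :> R by rewrite ltr0n.
have K0 : 0 <= 48 * delta * L * n%:R.
  by rewrite !mulr_ge0// ltW.
have e20 : 0 < eps ^+ 2 by rewrite exprn_gt0.
rewrite natrM mulrAC ltr_pdivrMr// => nT_gt.
have {}nT_gt y : y <= mx -> 48 * delta * L * n%:R * y < n%:R * T%:R * eps ^+ 2.
  by move=> ymx; apply: le_lt_trans nT_gt; rewrite ler_wpM2l.
pose X := 4 * L ^+ 2 * n%:R ^+ 3 * A * T%:R.
have X0 : 0 <= X by rewrite !mulr_ge0 ?exprn_ge0// ltW.
pose c := X `^ 3^-1.
have c0 : 0 <= c by exact: powR_ge0.
have cX : c ^+ 3 = X by exact: cube_root.
pose M1 := Num.sqrt 8 * n%:R * L.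
pose M3 := 4 * L * n%:R * B / eps.
have M10 : 0 < M1 by rewrite !mulr_gt0// sqrtr_gt0.
have M30 : 0 <= M3 by rewrite !mulr_ge0// ?invr_ge0 ltW.
(* gamma = 1 / M: [M1] and [c] encode the two stepsize restrictions, and [M3] keeps the [B] term at
   most eps^2 / 2. *)
pose M := Num.max M1 (Num.max c M3).
have M0 : 0 < M by rewrite lt_max M10.
have g0 : 0 < M^-1 by rewrite invr_gt0.
have gM3 : M^-1 * M3 <= 1 by rewrite ler_pdivrMl// mulr1 !le_max lexx !orbT.
have dM : 24 * delta * M < n%:R * T%:R * eps ^+ 2.
  have case1 : 24 * delta * M1 < n%:R * T%:R * eps ^+ 2.
    have := nT_gt (Num.sqrt 2); rewrite /mx le_max lexx => /(_ isT).
    by rewrite /M1 sqrt8; lra.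
  have case3 : 24 * delta * M3 < n%:R * T%:R * eps ^+ 2.
    have := nT_gt (2 * B / eps); rewrite /mx !le_max lexx !orbT => /(_ isT).
    by rewrite /M3; lra.
  (* [c] depends on T through a cube root, so cubes are compared: both sides become n T times the
     two sides of the squared budget inequality. *)
  have case2 : 24 * delta * c < n%:R * T%:R * eps ^+ 2.
    have := nT_gt (Num.sqrt (24 * delta * A) / eps).
    rewrite /mx !le_max lexx !orbT => /(_ isT).
    set N := n%:R * T%:R; have N0 : 0 < N by rewrite mulr_gt0.
    set S := Num.sqrt _; rewrite mulrA ltr_pdivrMr// => H.
    have S2 : S ^+ 2 = 24 * delta * A by rewrite sqr_sqrtr// !mulr_ge0.
    have H2 : (48 * delta * L * n%:R * S) ^+ 2 < (N * eps ^+ 2 * eps) ^+ 2.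
      by rewrite ltrXn2r ?nnegrE ?(mulr_ge0 K0 (sqrtr_ge0 _))//.
    have Ne0 : 0 <= N * eps ^+ 2 by rewrite mulr_ge0 ?sqr_ge0// ltW.
    rewrite -(@ltr_pXn2r _ 3) ?nnegrE// ?mulr_ge0//.
    have -> : (24 * delta * c) ^+ 3 = N * (48 * delta * L * n%:R * S) ^+ 2.
      rewrite 2!exprMn cX [(_ * S) ^+ 2]exprMn S2 /X /N; ring.
    have -> : (N * eps ^+ 2) ^+ 3 = N * (N * eps ^+ 2 * eps) ^+ 2 by ring.
    by rewrite ltr_pM2l.
  by rewrite /M; case: (leP M1 (Num.max c M3)) => // _; case: (leP c M3).
exists M^-1; split => //.
- by rewrite ler_pdivrMl// mulr1 le_max lexx.
- rewrite -/X -cX -exprMn exprn_ile1//; first by rewrite mulr_ge0// ltW.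
  by rewrite ler_pdivrMl// mulr1 !le_max lexx orbT.
- have -> : 12 * delta / (M^-1 * n%:R * T%:R) = 24 * delta * M / (n%:R * T%:R) / 2.
    by field; rewrite !gt_eqF.
  have -> : 8 * M^-1 ^+ 2 * L ^+ 2 * n%:R ^+ 2 * B ^+ 2
      = (M^-1 * M3) ^+ 2 * (eps ^+ 2 / 2).
    by rewrite /M3; field; rewrite !gt_eqF.
  have : 24 * delta * M / (n%:R * T%:R) < eps ^+ 2.
    by rewrite ltr_pdivrMr ?mulr_gt0// [ltRHS]mulrC.
  have : (M^-1 * M3) ^+ 2 <= 1 by rewrite exprn_ile1// mulr_ge0// ltW.
  move/(ler_wpM2r (ltW e20)); lra.
Qed.

End Stepsizes.

(** * Assembly of the four regimes *)

Theorem theorem5 (R : realType) :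
  exists (C : R) (p : nat), 0 < C /\
  forall (d n : nat) (f : 'I_n -> 'rV[R]_d -> R) (L fstar : R)
         (xstar x0 : 'rV[R]_d),
    (0 < n)%N -> 0 < L ->
    (forall i x, differentiable (f i) x) ->
    smooth L (favg f) -> (forall i, smooth L (f i)) ->
    (forall x, fstar <= favg f x) ->
    (convex (favg f) -> minimizer (favg f) xstar) ->
    let sigma := sigma_star f xstar in
    [/\ (* (1) *)
        forall mu : R, 0 < mu -> (forall i, strongly_convex mu (f i)) ->
        let kappa := L / mu in
        (forall (gamma : R) (T : nat), 0 < gamma -> gamma <= 1 / L -> (0 < T)%N ->
           enorm (IG f gamma x0 T - xstar) ^+ 2 <=
             (1 - gamma * mu) ^+ (n * T) * enorm (x0 - xstar) ^+ 2
             + gamma ^+ 2 * L * n%:R ^+ 2 * sigma ^+ 2 / mu) /\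
        (forall (eps : R) (T : nat), 0 < eps -> (0 < T)%N ->
           C * polylog p [:: L; mu; n%:R; enorm (x0 - xstar); sigma; 1 / eps]
             * (kappa + Num.sqrt kappa * n%:R * sigma / (mu * Num.sqrt eps))
             <= (n * T)%:R ->
           exists gamma : R, [/\ 0 < gamma, gamma <= 1 / L &
             enorm (IG f gamma x0 T - xstar) ^+ 2 <= eps]),
        (* (2) *)
        forall mu : R, 0 < mu -> strongly_convex mu (favg f) ->
        (forall i, convex (f i)) ->
        let kappa := L / mu in
        (forall (gamma : R) (T : nat), 0 < gamma ->
           gamma <= 1 / (Num.sqrt 2 * n%:R * L) -> (0 < T)%N ->
           enorm (IG f gamma x0 T - xstar) ^+ 2 <=
             (1 - gamma * mu * n%:R / 2) ^+ T * enorm (x0 - xstar) ^+ 2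
             + 2 * gamma ^+ 2 * kappa * n%:R ^+ 2 * sigma ^+ 2) /\
        (forall (eps : R) (T : nat), 0 < eps -> (0 < T)%N ->
           C * polylog p [:: L; mu; n%:R; enorm (x0 - xstar); sigma; 1 / eps]
             * (n%:R * kappa
                + Num.sqrt kappa * n%:R * sigma / (mu * Num.sqrt eps))
             <= (n * T)%:R ->
           exists gamma : R,
             [/\ 0 < gamma, gamma <= 1 / (Num.sqrt 2 * n%:R * L) &
             enorm (IG f gamma x0 T - xstar) ^+ 2 <= eps]),
        (* (3) *)
        (forall i, convex (f i)) ->
        (forall (gamma : R) (T : nat), 0 < gamma ->
           gamma <= 1 / (Num.sqrt 2 * n%:R * L) -> (0 < T)%N ->
           favg f (IG_avg f gamma x0 T) - favg f xstar <=
             enorm (x0 - xstar) ^+ 2 / (2 * gamma * n%:R * T%:R)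
             + gamma ^+ 2 * L * n%:R ^+ 2 * sigma ^+ 2 / 2) /\
        (forall (eps gamma : R) (T : nat), 0 < eps -> (0 < T)%N ->
           gamma%:E = Order.min
             (1%:E / (Num.sqrt 2 * n%:R * L)%:E)%E
             ((Num.sqrt eps)%:E / (Num.sqrt L * n%:R * sigma)%:E)%E ->
           enorm (x0 - xstar) ^+ 2 / eps
             * Num.max (Num.sqrt 8 * n%:R * L)
                       (Num.sqrt L * sigma * n%:R / Num.sqrt eps)
             <= (n * T)%:R ->
           favg f (IG_avg f gamma x0 T) - favg f xstar <= eps)
      & (* (4) *)
        forall A B : R, 0 <= A -> 0 <= B ->
        (forall x, n%:R^-1 * \sum_(i < n)
             enorm (grad (f i) x - grad (favg f) x) ^+ 2
           <= 2 * A * (favg f x - fstar) + B ^+ 2) ->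
        (forall (gamma : R) (T : nat), 0 < gamma -> (0 < T)%N ->
           (gamma%:E <= nonconvex_step_max L A n T)%E ->
           \big[Num.min/enorm (grad (favg f) x0) ^+ 2]_(t < T)
               enorm (grad (favg f) (IG f gamma x0 t)) ^+ 2
             <= 12 * (favg f x0 - fstar) / (gamma * n%:R * T%:R)
                + 8 * gamma ^+ 2 * L ^+ 2 * n%:R ^+ 2 * B ^+ 2) /\
        (forall (eps : R) (T : nat), 0 < eps -> (0 < T)%N ->
           48 * (favg f x0 - fstar) * L * n%:R / eps ^+ 2
             * Num.max (Num.sqrt 2)
                 (Num.max (Num.sqrt (24 * (favg f x0 - fstar) * A) / eps)
                          (2 * B / eps))
             < (n * T)%:R ->
           exists gamma : R, [/\ 0 < gamma,
             (gamma%:E <= nonconvex_step_max L A n T)%E &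
             exists t : nat, (t < T)%N /\
               enorm (grad (favg f) (IG f gamma x0 t)) < eps])].
Proof.
(* Regime (2) fixes 16: [contraction_le_half] asks for gamma mu n T >= 4 s with s the logarithmic
   term, and the stepsize guarantees only 4 gamma mu (n kappa + Q) >= 1. *)
exists 16, 1%N; split; first by [].
move=> d n f L fstar xstar x0 n0 L0 df Lfavg Lf fstar_le xmin sigma.
have dfavg x : differentiable (favg f) x.
  by apply: differentiable_favg => i; exact: df.
have nR : 0 < n%:R :> R by rewrite ltr0n.
have sigma0 : 0 <= sigma by exact: sqrtr_ge0.
have grad0 : convex (favg f) -> grad (favg f) xstar = 0.
  by move/xmin; exact: minimizer_grad0 L0 dfavg Lfavg.
have norm0 (v : 'rV[R]_d) : d = 0%N -> enorm v = 0.
  by move=> dE; move: v; rewrite dE; exact: enorm_dim0.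
have step2_gt0 : 0 < Num.sqrt 2 * n%:R * L by rewrite !mulr_gt0// sqrtr_gt0.
have step2P gamma : 0 < gamma -> gamma <= 1 / (Num.sqrt 2 * n%:R * L) ->
    2 * (gamma * n%:R * L) ^+ 2 <= 1.
  move=> g0; rewrite ler_pdiv1// => gL.
  by apply: stepsize_sqr; rewrite ?(ltW L0) ?(ltW g0).
have polylog_ge mu eps : 0 < mu -> 0 < eps ->
    1 + ln (1 + enorm (x0 - xstar)) + ln (1 + 1 / eps)
    <= polylog 1 [:: L; mu; n%:R; enorm (x0 - xstar); sigma; 1 / eps].
  move=> mu0 eps0.
  by apply: polylog1_ge; rewrite ?(ltW L0) ?(ltW mu0) ?(ltW nR) ?enorm_ge0.
have log_ge0 eps : 0 < eps ->
    0 <= 1 + ln (1 + enorm (x0 - xstar)) + ln (1 + 1 / eps).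
  move=> eps0; rewrite !addr_ge0// ln_ge0// lerDl ?enorm_ge0//.
  by rewrite divr_ge0// ltW.
split.
- move=> mu mu0 cf kappa.
  have cf0 i : convex (f i) by exact: strongly_convexW (ltW mu0) (cf i).
  have xs0 := grad0 (convex_favg cf0).
  have muL : (0 < d)%N -> mu <= L.
    move=> d0; pose i := Ordinal n0.
    exact: strongly_convex_le_smooth d0 (ltW L0) (df i) (Lf i) (cf i).
  have kappa0 : 0 <= kappa by rewrite divr_ge0 ?ltW.
  have bound gamma T : 0 < gamma -> gamma <= 1 / L ->
      enorm (IG f gamma x0 T - xstar) ^+ 2 <=
        (1 - gamma * mu) ^+ (n * T) * enorm (x0 - xstar) ^+ 2
        + gamma ^+ 2 * L * n%:R ^+ 2 * sigma ^+ 2 / mu.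
    move=> g0; rewrite ler_pdiv1// => gL.
    (* In dimension 0 [mu] may exceed [L] and 1 - gamma mu may be negative, but all norms vanish and
       only the noise term remains. *)
    have [d0|d0] := posnP d.
      rewrite !norm0// expr0n/= mulr0 add0r.
      by rewrite !(sqr_ge0, invr_ge0, mulr_ge0)// ?(ltW L0) ?(ltW mu0).
    apply: IG_strongly_convex_components => //.
    by apply: le_trans gL; rewrite ler_pM2l// muL.
  split=> [gamma T g0 gL _|eps T eps0 T0 budget]; first exact: bound.
  have [gamma [g0 gL noise contr]] :=
    strongly_convex_stepsize n L0 mu0 sigma0 eps0 kappa0.
  exists gamma; split=> //; first by rewrite ler_pdiv1.
  have [d0|d0] := posnP d; first by rewrite norm0// expr0n/= ltW.
  apply: le_trans (bound gamma T g0 _) _; first by rewrite ler_pdiv1.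
  have -> : gamma ^+ 2 * L * n%:R ^+ 2 * sigma ^+ 2 / mu
      = gamma ^+ 2 * kappa * n%:R ^+ 2 * sigma ^+ 2 by rewrite /kappa; ring.
  have gmu : gamma * mu <= 1.
    by apply: le_trans gL; rewrite ler_pM2l// muL.
  have gm0 : 0 < gamma * mu by rewrite mulr_gt0.
  suff : (1 - gamma * mu) ^+ (n * T) * enorm (x0 - xstar) ^+ 2 <= eps / 2.
    by move: noise; lra.
  apply: contraction_le_half; rewrite ?enorm_ge0 ?gmu ?(ltW gm0)//.
  apply: le_trans (ler_wpM2l (ltW gm0) budget).
  move: contr; rewrite -/kappa.
  set Q := _ / (mu * _) => contr.
  have Q0 : 0 <= Q.
    by rewrite !mulr_ge0 ?sqrtr_ge0// invr_ge0 mulr_ge0 ?sqrtr_ge0// ltW.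
  have H1 : 1 <= 4 * (gamma * mu * (kappa + Q)).
    apply: le_trans contr _.
    by have := mulr_ge0 (ltW gm0) kappa0; lra.
  have := polylog_ge mu eps mu0 eps0; have := log_ge0 _ eps0.
  set s := 1 + _ + _; set P := polylog _ _ => s0 sP.
  have P0 : 0 <= P by exact: le_trans sP.
  have := ler_wpM2l P0 H1; lra.
- move=> mu mu0 cfavg cf kappa.
  have xs0 := grad0 (convex_favg cf).
  have muL : (0 < d)%N -> mu <= L.
    by move=> d0; exact: strongly_convex_le_smooth d0 (ltW L0) dfavg Lfavg cfavg.
  have kappa0 : 0 <= kappa by rewrite divr_ge0 ?ltW.
  have bound gamma T : 0 < gamma -> gamma <= 1 / (Num.sqrt 2 * n%:R * L) ->
      enorm (IG f gamma x0 T - xstar) ^+ 2 <=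
        (1 - gamma * mu * n%:R / 2) ^+ T * enorm (x0 - xstar) ^+ 2
        + 2 * gamma ^+ 2 * kappa * n%:R ^+ 2 * sigma ^+ 2.
    move=> g0 gL; have [d0|d0] := posnP d.
      rewrite !norm0// expr0n/= mulr0 add0r.
      by rewrite !(sqr_ge0, invr_ge0, mulr_ge0)// ltW.
    apply: (IG_strongly_convex_average n0 L0 df Lf Lfavg) => //.
      exact: step2P.
    exact: muL.
  split=> [gamma T g0 gL _|eps T eps0 T0 budget]; first exact: bound.
  have [gamma [g0 gL noise contr]] :=
    strongly_convex_stepsize n step2_gt0 mu0 sigma0 eps0 kappa0.
  exists gamma; split=> //; first by rewrite ler_pdiv1.
  have [d0|d0] := posnP d; first by rewrite norm0// expr0n/= ltW.
  apply: le_trans (bound gamma T g0 _) _; first by rewrite ler_pdiv1.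
  have gm0 : 0 < gamma * mu * n%:R / 2 by rewrite !mulr_gt0// invr_gt0.
  have gmu : gamma * mu * n%:R / 2 <= 1.
    have : gamma * n%:R * mu <= gamma * n%:R * L.
      by rewrite ler_wpM2l ?muL// mulr_ge0// ltW.
    have : gamma * n%:R * L <= gamma * (Num.sqrt 2 * n%:R * L).
      have -> : gamma * (Num.sqrt 2 * n%:R * L)
          = Num.sqrt 2 * (gamma * n%:R * L) by ring.
      rewrite ler_peMl ?mulr_ge0 ?(ltW g0) ?(ltW L0)//.
      by rewrite -(@ler_pXn2r _ 2) ?nnegrE ?sqrtr_ge0// sqr_sqrtr//; lra.
    lra.
  suff : (1 - gamma * mu * n%:R / 2) ^+ T * enorm (x0 - xstar) ^+ 2 <= eps / 2.
    by move: noise; lra.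
  apply: contraction_le_half; rewrite ?enorm_ge0 ?gmu ?(ltW gm0)//.
  have gm0' : 0 < gamma * mu by rewrite mulr_gt0.
  have := ler_wpM2l (ltW gm0') budget; rewrite natrM.
  move: contr; set Q := _ / (mu * _) => contr.
  have Q0 : 0 <= Q.
    by rewrite !mulr_ge0 ?sqrtr_ge0// invr_ge0 mulr_ge0 ?sqrtr_ge0// ltW.
  have H1 : 1 <= 4 * (gamma * mu * (n%:R * kappa + Q)).
    apply: le_trans contr _.
    have -> : Num.sqrt 2 * n%:R * L / mu = Num.sqrt 2 * (n%:R * kappa).
      by rewrite /kappa; ring.
    have nk0 : 0 <= gamma * mu * (n%:R * kappa).
      by rewrite mulr_ge0 ?(ltW gm0')// mulr_ge0 ?(ltW nR).
    have := ler_wpM2r nk0 (@sqrt2_le R); lra.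
  have := polylog_ge mu eps mu0 eps0; have := log_ge0 _ eps0.
  set s := 1 + _ + _; set P := polylog _ _ => s0 sP.
  have P0 : 0 <= P by exact: le_trans sP.
  have := ler_wpM2l P0 H1; lra.
- move=> cf; have xs0 := grad0 (convex_favg cf).
  have bound gamma T : 0 < gamma -> gamma <= 1 / (Num.sqrt 2 * n%:R * L) ->
      (0 < T)%N ->
      favg f (IG_avg f gamma x0 T) - favg f xstar <=
        enorm (x0 - xstar) ^+ 2 / (2 * gamma * n%:R * T%:R)
        + gamma ^+ 2 * L * n%:R ^+ 2 * sigma ^+ 2 / 2.
    move=> g0 gL T0.
    by apply: (IG_convex_average n0 L0 df Lf Lfavg) => //; exact: step2P.
  split=> // eps gamma T eps0 T0 gE budget.
  have se0 : 0 < Num.sqrt eps by rewrite sqrtr_gt0.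
  have Y0 : 0 <= Num.sqrt L * n%:R * sigma by rewrite !mulr_ge0 ?sqrtr_ge0.
  have [g0 gX gY gmax] := min_stepsizeP step2_gt0 Y0 se0 gE.
  have TR : 0 < T%:R :> R by rewrite ltr0n.
  apply: le_trans (bound gamma T g0 _ T0) _; first by rewrite ler_pdiv1.
  have noise : gamma ^+ 2 * L * n%:R ^+ 2 * sigma ^+ 2 <= eps.
    have -> : gamma ^+ 2 * L * n%:R ^+ 2 * sigma ^+ 2
        = (gamma * (Num.sqrt L * n%:R * sigma)) ^+ 2.
      by rewrite -{1}(sqr_sqrtr (ltW L0)); ring.
    rewrite -[leRHS](sqr_sqrtr (ltW eps0)).
    by rewrite lerXn2r ?nnegrE ?mulr_ge0 ?(ltW g0) ?(ltW se0).
  suff : enorm (x0 - xstar) ^+ 2 / (2 * gamma * n%:R * T%:R) <= eps / 2 by lra.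
  rewrite ler_pdivrMr ?mulr_gt0//.
  move: budget; set r := enorm _ ^+ 2.
  rewrite [r / eps * _]mulrAC ler_pdivrMr// natrM => budget.
  (* The budget carries sqrt 8 = 2 sqrt 2 where the stepsize has sqrt 2, so its maximum
     dominates. *)
  have max_le : Num.max (Num.sqrt 2 * n%:R * L) (Num.sqrt L * n%:R * sigma / Num.sqrt eps)
      <= Num.max (Num.sqrt 8 * n%:R * L) (Num.sqrt L * sigma * n%:R / Num.sqrt eps).
    rewrite ge_max !le_max [_ * sigma * _]mulrAC lexx orbT andbT sqrt8.
    by apply/orP; left; have := step2_gt0; lra.
  have r0 : 0 <= r by exact: sqr_ge0.
  have H1 := ler_wpM2l r0 (le_trans gmax (ler_wpM2l (ltW g0) max_le)).
  have := ler_wpM2l (ltW g0) budget; lra.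
- move=> A B A0 B0 var_le.
  have stepE gamma T : 0 < gamma -> (gamma%:E <= nonconvex_step_max L A n T)%E ->
      8 * (gamma * n%:R * L) ^+ 2 <= 1
      /\ gamma ^+ 3 * (4 * L ^+ 2 * n%:R ^+ 3 * A * T%:R) <= 1.
    move=> g0 /(nonconvex_step_maxP _ _ (ltW L0) A0 (ltW g0))[gL gA]; split=> //.
    by apply: stepsize_sqr; rewrite ?(ltW L0) ?(ltW g0).
  split=> [gamma T g0 T0 /(stepE _ _ g0)[gL gA]|eps T eps0 T0 budget].
    apply: (IG_nonconvex_le n0 L0 df Lf Lfavg g0 gL A0 fstar_le var_le T0 gA).
    by move=> t tT; exact: (bigmin_le _ (Ordinal tT)).
  have delta0 : 0 <= favg f x0 - fstar by rewrite subr_ge0.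
  have [gamma [g0 gL gA small]] :=
    nonconvex_stepsize L0 A0 B0 eps0 delta0 n0 T0 budget.
  exists gamma; split=> //.
    by apply/(nonconvex_step_maxP _ _ (ltW L0) A0 (ltW g0)).
  (* If every gradient had norm at least eps, [m = eps ^+ 2] would be an admissible lower bound, yet
     the right-hand side is strictly below it. *)
  apply/not_existsP => all_large.
  suff : eps ^+ 2 < eps ^+ 2 by rewrite ltxx.
  apply: le_lt_trans small.
  have gL' : 8 * (gamma * n%:R * L) ^+ 2 <= 1.
    by apply: stepsize_sqr; rewrite ?(ltW L0) ?(ltW g0).
  apply: (IG_nonconvex_le n0 L0 df Lf Lfavg g0 gL' A0 fstar_le var_le T0 gA).
  move=> t tT; rewrite lerXn2r ?nnegrE ?enorm_ge0 ?(ltW eps0)// leNgt.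
  by apply/negP => ?; apply: (all_large t).
Qed.
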